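(* Let $\mathcal T=(T(t))_{t\ge0}$ be a $C_0$-semigroup on a Hilbert space $H$. Assume there exist $\lambda>0$ and $\tau>0$ such that (i) the rescaled semigroup $e_{-\lambda}\mathcal T=(e^{-\lambda t}T(t))_{t\ge0}$ is similar to a semigroup of contractions, and (ii) $T(\tau)$ is similar to a contraction. Then $\mathcal T$ is similar to a semigroup of contractions, and $$\mathcal C(\mathcal T)\le\sqrt2\,\mathcal C(e_{-\lambda}\mathcal T)\,\frac{e^{2\lambda}-1}{2\lambda}+2\sqrt2\,C(T(\tau))\,M^2\max\{1,\sqrt\tau\},$$ where $M=\sup_{t\in[0,\tau]}\|T(t)\|$.
   Context: For $T\in\mathcal L(H)$: $C(T)=\inf\{\|R\|\|R^{-1}\|: R\text{ invertible},\ \|RTR^{-1}\|\le1\}$ ($=\infty$ if no such $R$ exists), and $T$ is similar to a contraction if such $R$ exists. For a $C_0$-semigroup $\mathcal S=(S(t))_{t\ge0}$ on $H$: $\mathcal C(\mathcal S)=\inf\{\|R\|\|R^{-1}\|: R\text{ invertible},\ \|RS(t)R^{-1}\|\le1\ \forall t\ge0\}$ ($=\infty$ if no such $R$ exists), and $\mathcal S$ is similar to a semigroup of contractions if such $R$ exists. *)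

(* Defs.v *)
(* MathComp + MathComp-Analysis + real-closed's complex numbers R[i]. *)
From HB Require Import structures.
From mathcomp Require Import all_boot all_order all_algebra.
From mathcomp Require Import all_classical all_reals all_analysis.
From mathcomp Require Import complex.
Set Implicit Arguments. Unset Strict Implicit. Unset Printing Implicit Defensive.
Import Order.TTheory GRing.Theory Num.Theory.
Local Open Scope classical_set_scope.
Local Open Scope ring_scope.

Section HilbertDefs.
Variables (R : realType) (H : lmodType R[i]) (ip : H -> H -> R[i]).

(* ip is an inner product: linear in the first argument, conjugate symmetric,
   positive definite. *)
Definition is_inner_product : Prop :=
  (forall (a : R[i]) (x y z : H), ip (a *: x + y) z = a * ip x z + ip y z) /\
  (forall x y : H, ip y x = ((ip x y)^*)%C) /\
  (forall x : H, 0 <= complex.Re (ip x x)) /\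
  (forall x : H, ip x x = 0 -> x = 0).

(* the induced norm ||x|| = sqrt <x,x> *)
Definition hnorm (x : H) : R := Num.sqrt (complex.Re (ip x x)).

Definition hilbert_complete : Prop :=
  forall u : nat -> H,
    (forall e : R, 0 < e -> exists N : nat, forall m n : nat,
        (N <= m)%N -> (N <= n)%N -> hnorm (u m - u n) < e) ->
    exists l : H, forall e : R, 0 < e -> exists N : nat, forall n : nat,
        (N <= n)%N -> hnorm (u n - l) < e.

(* (H, ip) is a (complex) Hilbert space *)
Definition is_hilbert : Prop := is_inner_product /\ hilbert_complete.

(* f belongs to L(H): linear and bounded *)
Definition bounded_op (f : H -> H) : Prop :=
  (forall (a : R[i]) (x y : H), f (a *: x + y) = a *: f x + f y) /\
  exists c : R, forall x : H, hnorm (f x) <= c * hnorm x.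

(* operator norm *)
Definition opnorm (f : H -> H) : R :=
  sup [set hnorm (f x) | x in [set x : H | hnorm x <= 1]].

(* Rinv is the inverse in L(H) of the operator Rop *)
Definition invertible_pair (Rop Rinv : H -> H) : Prop :=
  bounded_op Rop /\ bounded_op Rinv /\
  (forall x, Rop (Rinv x) = x) /\ (forall x, Rinv (Rop x) = x).

(* T is similar to a contraction *)
Definition similar_to_contraction (T : H -> H) : Prop :=
  exists Rop Rinv, invertible_pair Rop Rinv /\
    opnorm (fun x => Rop (T (Rinv x))) <= 1.

(* C(T) = inf { ||R|| ||R^-1|| : R invertible, ||R T R^-1|| <= 1 }  (+oo if empty) *)
Definition sim_const (T : H -> H) : \bar R :=
  ereal_inf [set r : \bar R | exists Rop Rinv, invertible_pair Rop Rinv /\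
    opnorm (fun x => Rop (T (Rinv x))) <= 1 /\
    r = (opnorm Rop * opnorm Rinv)%:E].

(* C_0-semigroup (T(t))_{t >= 0}; values of T at t < 0 are irrelevant *)
Definition C0_semigroup (T : R -> H -> H) : Prop :=
  (forall t, 0 <= t -> bounded_op (T t)) /\
  (forall x, T 0 x = x) /\
  (forall s t, 0 <= s -> 0 <= t -> forall x, T (s + t) x = T s (T t x)) /\
  (forall (x : H) (e : R), 0 < e -> exists d : R, 0 < d /\
     forall t, 0 <= t -> t < d -> hnorm (T t x - x) < e).

(* the semigroup is similar to a semigroup of contractions *)
Definition sg_similar_to_contractions (T : R -> H -> H) : Prop :=
  exists Rop Rinv, invertible_pair Rop Rinv /\
    forall t, 0 <= t -> opnorm (fun x => Rop (T t (Rinv x))) <= 1.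

(* \mathcal C(S) *)
Definition sg_sim_const (T : R -> H -> H) : \bar R :=
  ereal_inf [set r : \bar R | exists Rop Rinv, invertible_pair Rop Rinv /\
    (forall t, 0 <= t -> opnorm (fun x => Rop (T t (Rinv x))) <= 1) /\
    r = (opnorm Rop * opnorm Rinv)%:E].

(* e_{-lam} T = (e^{-lam t} T(t))_{t >= 0} *)
Definition rescale (lam : R) (T : R -> H -> H) : R -> H -> H :=
  fun t x => ((expR (- lam * t))%:C)%C *: T t x.

(* M = sup_{t in [0, tau]} ||T(t)|| *)
Definition sup_norm_on (T : R -> H -> H) (tau : R) : R :=
  sup [set opnorm (T t) | t in [set t : R | 0 <= t <= tau]].

End HilbertDefs.

(* Main.v *)
Require Import Defs.
From HB Require Import structures.
From mathcomp Require Import all_boot all_order all_algebra.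
From mathcomp Require Import all_classical all_reals all_analysis.
From mathcomp Require Import complex ring lra.
Import Order.TTheory GRing.Theory Num.Theory numFieldNormedType.Exports.
Local Open Scope classical_set_scope.
Local Open Scope ring_scope.

(** Put [A = T (tau / N)]. A vector [w] is reached by finitely supported trajectories
    [.., x 2, x 1, x 0 = w] with inputs [x j - A (x j.+1)]. Give each trajectory a cost that
    is a nonnegative quadratic form, so that the minimal cost [q] of reaching [w] still obeys
    the parallelogram law, and that does not increase when the trajectory is prolonged by one
    free step of [A], so that [q (A w) <= q w].

    With [u p = w - A^(p+1) (x (p+1))] and [0 <= p < n], where [n tau / N] is about
    [min 1 tau], the cost is a weighted sum of
    - [sum_p e^(-2 lam p tau / N) |R1 (u p)|^2],
    - [sum_(s < N) |R2 A^s w|^2 + sum_(j >= 1) (|R2 (x j)|^2 - |R2 T(tau) (x j)|^2)],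
    - [sum_p |R2 A^(N-1-p) (u p)|^2],
    where [R1] makes [e_{-lam} T] contractive and [R2] makes [T tau] contractive. The first
    sum is the squared norm of a nilpotent weighted shift, the second one that of the
    isometric dilation of [R2 T(tau) R2^-1]. The first sum bounds [u p], the other two bound
    [x (p+1)], and [w = u p + A^(p+1) (x (p+1))]. So [q] is equivalent to the squared norm
    of [H] with constants that do not depend on [N].

    An ultrafilter limit along [N = N0 2^k] gives a form that does not increase along
    [T t] for a dense set of [t], hence for all [t]. It is [|R x|^2] for an invertible [R],
    by the Jordan-von Neumann and Riesz theorems and a positive square root. *)

(** * Hilbert space geometry *)

Section Hilbert.
Context {R : realType} {H : lmodType R[i]} {ip : H -> H -> R[i]}.
Hypothesis hip : is_inner_product ip.

Local Notation hn := (hnorm ip).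

(** Two modules are allowed so that maps on trajectories [nat -> H] qualify. *)
Definition linop {V W : lmodType R[i]} (f : V -> W) : Prop :=
  forall (a : R[i]) (x y : V), f (a *: x + y) = a *: f x + f y.

Definition ipr (x y : H) : R := complex.Re (ip x y).

Lemma ReD (a b : R[i]) : complex.Re (a + b) = complex.Re a + complex.Re b.
Proof. by case: a b => [? ?] [? ?]. Qed.

Lemma ReCM (a : R) (b : R[i]) : complex.Re (a%:C%C * b) = a * complex.Re b.
Proof. by case: b => [? ?] /=; ring. Qed.

Lemma ipr0l y : ipr 0 y = 0.
Proof.
case: hip => hl _; move: (hl 1 0 0 y); rewrite scaler0 addr0 mul1r /ipr => h.
have : complex.Re (ip 0 y) = complex.Re (ip 0 y) + complex.Re (ip 0 y).
  by rewrite -ReD -h.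
lra.
Qed.

Lemma iprDl x y z : ipr (x + y) z = ipr x z + ipr y z.
Proof.
by case: hip => hl _; rewrite /ipr -{1}[x]scale1r hl mul1r ReD.
Qed.

Lemma ipZl a x y : ip (a *: x) y = a * ip x y.
Proof.
case: hip => hl _.
have h0 : ip 0 y = 0.
  move: (hl 1 0 0 y); rewrite scaler0 addr0 mul1r => h.
  by apply: (addrI (ip 0 y)); rewrite addr0 -h.
by rewrite -[a *: x]addr0 hl h0 addr0.
Qed.

Lemma iprZl (a : R) x y : ipr (a%:C%C *: x) y = a * ipr x y.
Proof. by rewrite /ipr ipZl ReCM. Qed.

Lemma iprC x y : ipr x y = ipr y x.
Proof.
by case: hip => _ [hc _]; rewrite /ipr hc; case: (ip y x).
Qed.

Lemma iprDr x y z : ipr z (x + y) = ipr z x + ipr z y.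
Proof. by rewrite iprC iprDl !(iprC z). Qed.

Lemma iprZr (a : R) x y : ipr y (a%:C%C *: x) = a * ipr y x.
Proof. by rewrite iprC iprZl (iprC y). Qed.

Lemma iprNl x y : ipr (- x) y = - ipr x y.
Proof.
apply/eqP; rewrite -addr_eq0 -iprDl addNr ipr0l eqxx //.
Qed.

Lemma iprNr x y : ipr y (- x) = - ipr y x.
Proof. by rewrite iprC iprNl (iprC y). Qed.

Lemma iprZZ (a : R[i]) x y : ipr (a *: x) y = ipr x ((a^*)%C *: y).
Proof.
rewrite /ipr; case: hip => _ [hc _].
rewrite ipZl (hc ((a^*)%C *: y) x) ipZl (hc x y).
by case: a (ip x y) => [? ?] [? ?] /=; ring.
Qed.

Lemma ipr_ge0 x : 0 <= ipr x x.
Proof. by case: hip => _ [_ [h _]]; exact: h. Qed.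

Lemma hn_ge0 x : 0 <= hn x.
Proof. exact: sqrtr_ge0. Qed.

Lemma hn2 x : hn x ^+ 2 = ipr x x.
Proof. by rewrite sqr_sqrtr // ipr_ge0. Qed.

Lemma hn0_eq0 x : hn x = 0 -> x = 0.
Proof.
move=> h; case: hip => _ [hc [_ h0]]; apply: h0.
have h1 : complex.Re (ip x x) = 0 by have := hn2 x; rewrite h expr0n /= /ipr.
have := hc x x; move: h1; case: (ip x x) => a b /= -> [] hb.
by congr (Complex _ _); lra.
Qed.

Lemma hn0 : hn 0 = 0.
Proof. by apply/eqP; rewrite -sqrf_eq0 hn2 ipr0l. Qed.

(** Expanding [|t x - y|^2 >= 0] at [t = |y| / |x|] gives the bound unsquared, once zero norms are
    split off. *)
Lemma ipr_le_hnorm x y : ipr x y <= hn x * hn y.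
Proof.
have key (t : R) : 0 <= t ^+ 2 * hn x ^+ 2 - 2 * t * ipr x y + hn y ^+ 2.
  have := ipr_ge0 (t%:C%C *: x - y).
  rewrite iprDl !iprDr iprNl !iprNr !iprZl !iprZr iprNl (iprC y) -!hn2.
  lra.
have [x0|x0] := eqVneq (hn x) 0.
  by rewrite (hn0_eq0 x x0) ipr0l hn0 mul0r.
have [y0|y0] := eqVneq (hn y) 0.
  by rewrite (hn0_eq0 y y0) iprC ipr0l hn0 mulr0.
have xp : 0 < hn x by rewrite lt_def x0 hn_ge0.
have yp : 0 < hn y by rewrite lt_def y0 hn_ge0.
have := key (hn y / hn x).
have -> : (hn y / hn x) ^+ 2 * hn x ^+ 2 - 2 * (hn y / hn x) * ipr x y + hn y ^+ 2
  = 2 * (hn y / hn x) * (hn x * hn y - ipr x y) by field.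
by rewrite pmulr_rge0 ?subr_ge0 // mulr_gt0 ?divr_gt0.
Qed.

Lemma hnZ2 (a : R[i]) x :
  hn (a *: x) ^+ 2 = (complex.Re a ^+ 2 + complex.Im a ^+ 2) * hn x ^+ 2.
Proof.
rewrite !hn2 iprZZ scalerA /ipr; case: hip => _ [hc _].
rewrite (hc _ x) ipZl.
have := hc x x; case: a (ip x x) => [a b] [c d] /= [] hd.
have -> : d = 0 by lra.
ring.
Qed.

Lemma hnZ (a : R) x : hn (a%:C%C *: x) = `|a| * hn x.
Proof.
apply/eqP; rewrite -(eqrXn2 (n := 2)) ?hn_ge0 ?mulr_ge0 ?hn_ge0 //.
by rewrite hnZ2 /= exprMn real_normK ?num_real // expr0n addr0.
Qed.

Lemma hnN x : hn (- x) = hn x.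
Proof.
apply/eqP; rewrite -(eqrXn2 (n := 2)) ?hn_ge0 //.
by rewrite !hn2 iprNl iprNr opprK.
Qed.

Lemma hnBC x y : hn (x - y) = hn (y - x).
Proof. by rewrite -hnN opprB. Qed.

Lemma hnD2 x y : hn (x + y) ^+ 2 = hn x ^+ 2 + 2 * ipr x y + hn y ^+ 2.
Proof. by rewrite !hn2 iprDl !iprDr (iprC y); ring. Qed.

Lemma hnD x y : hn (x + y) <= hn x + hn y.
Proof.
rewrite -(ler_pXn2r (n := 2)) ?nnegrE ?addr_ge0 ?hn_ge0 // hnD2.
by have := ipr_le_hnorm x y; rewrite sqrrD; lra.
Qed.

Lemma hnB x y z : hn (x - z) <= hn (x - y) + hn (y - z).
Proof. by have := hnD (x - y) (y - z); rewrite addrA subrK. Qed.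

Lemma hn_parallelogram x y :
  hn (x + y) ^+ 2 + hn (x - y) ^+ 2 = 2 * (hn x ^+ 2 + hn y ^+ 2).
Proof. by rewrite !hnD2 hnN iprNr; ring. Qed.

Lemma ipr_inj x y : (forall z, ipr x z = ipr y z) -> x = y.
Proof.
move=> h; apply/eqP; rewrite -subr_eq0; apply/eqP/hn0_eq0/eqP.
by rewrite -sqrf_eq0 hn2 iprDl iprNl h subrr.
Qed.

Lemma linop0 (V W : lmodType R[i]) (f : V -> W) : linop f -> f 0 = 0.
Proof. by move=> h; have := h (-1) 0 0; rewrite scaler0 addr0 scaleN1r addNr. Qed.

Lemma linopZ (V W : lmodType R[i]) (f : V -> W) : linop f ->
  forall a x, f (a *: x) = a *: f x.
Proof. by move=> h a x; have := h a x 0; rewrite !addr0 (@linop0 V W) // addr0. Qed.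

Lemma linopD (V W : lmodType R[i]) (f : V -> W) : linop f ->
  forall x y, f (x + y) = f x + f y.
Proof. by move=> h x y; have := h 1 x y; rewrite !scale1r. Qed.

Lemma linopB (V W : lmodType R[i]) (f : V -> W) : linop f ->
  forall x y, f (x - y) = f x - f y.
Proof.
by move=> h x y; rewrite -[- y]scaleN1r (@linopD V W) // (@linopZ V W) // scaleN1r.
Qed.

Lemma linop_iter (f : H -> H) n : linop f -> linop (iter n f).
Proof. by move=> h; elim: n => [|n ih] a x y //=; rewrite ih h. Qed.

(** Identities for limits are proved with this: a defect independent of [n] is bounded, for every
    [n], by a geometric error. *)
Lemma le_geom_eq0 (y e K : R) : 0 <= y -> y < 1 ->
  (forall n, e <= K * y ^+ n) -> e <= 0.
Proof.
move=> y0 y1 h; have hc : (K * y ^+ n @[n --> \oo] --> (K * 0 : R))%classic.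
  by apply: cvgMr; apply: cvg_expr; rewrite ger0_norm.
rewrite -(mulr0 K) -(cvg_lim _ hc) //.
apply: limr_ge; first by apply/cvg_ex; exists (K * 0).
by apply: nearW.
Qed.

(** The increments telescope; the rate is kept explicit for later use with [le_geom_eq0]. *)
Lemma geom_cauchy (u : nat -> H) (y C : R) : hilbert_complete ip ->
  0 <= y -> y < 1 -> (forall n, hn (u n.+1 - u n) <= C * y ^+ n) ->
  exists l, forall n, hn (u n - l) <= C / (1 - y) * y ^+ n.
Proof.
move=> hcomp y0 y1 h.
have C0 : 0 <= C.
  by have := h 0; rewrite expr0 mulr1; apply: le_trans; exact: hn_ge0.
have y1' : 0 < 1 - y by lra.
have hK (n : nat) k : hn (u (n + k)%N - u n) <= C / (1 - y) * (y ^+ n - y ^+ (n + k)).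
  elim: k => [|k ih]; first by rewrite addn0 !subrr hn0 mulr0.
  apply: le_trans (hnB _ (u (n + k)%N) _) _.
  rewrite addnS; apply: le_trans (lerD (h _) ih) _.
  rewrite exprS le_eqVlt; apply/orP; left; apply/eqP.
  by field; rewrite gt_eqF.
have hK' (n m : nat) : (n <= m)%N -> hn (u m - u n) <= C / (1 - y) * y ^+ n.
  move=> nm; rewrite -(subnKC nm); apply: le_trans (hK _ _) _.
  apply: ler_wpM2l; first by rewrite divr_ge0 // ltW.
  by have := exprn_ge0 (n + (m - n)) y0; lra.
have [l hl] : exists l, forall e : R, 0 < e -> exists N : nat, forall n : nat,
        (N <= n)%N -> hn (u n - l) < e.
  apply: hcomp => e e0.
  have hc : (C / (1 - y) * y ^+ n @[n --> \oo] --> (C / (1 - y) * 0 : R))%classic.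
    by apply: cvgMr; apply: cvg_expr; rewrite ger0_norm.
  move: hc; rewrite mulr0 => /cvgrPdist_lt /(_ (e / 2)).
  rewrite divr_gt0 // => /(_ isT) [N _ hN]; exists N => m n Nm Nn.
  have := hN N (leqnn N); rewrite sub0r normrN ger0_norm; last first.
    by apply: mulr_ge0; [rewrite divr_ge0 // ltW | rewrite exprn_ge0].
  move=> hNe; apply: le_lt_trans (hnB _ (u N) _) _.
  rewrite (hnBC (u N)); have := hK' _ _ Nm; have := hK' _ _ Nn; lra.
exists l => n; rewrite -subr_le0 leNgt; apply/negP => he.
have [N hN] := hl _ he.
have := hN (maxn N n) (leq_maxl _ _); have := hK' n (maxn N n) (leq_maxr _ _).
have := hnB (u n) (u (maxn N n)) l.
rewrite (hnBC (u n) (u (maxn N n))); lra.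
Qed.

End Hilbert.

(** * Quadratic forms and their polar forms *)

Section QuadraticForm.
Context {R : realType} {V : lmodType R[i]}.

(** A form is recorded by its values alone, so that infima and limits of forms can be treated; the
    factor is [|c|^2]. *)
Definition quadform (q : V -> R) : Prop :=
  (forall x y, q (x + y) + q (x - y) = 2 * (q x + q y)) /\
  (forall (c : R[i]) x, q (c *: x) = (complex.Re c ^+ 2 + complex.Im c ^+ 2) * q x).

Definition polar (q : V -> R) (x y : V) : R := (q (x + y) - q (x - y)) / 4.

Context {q : V -> R}.
Hypotheses (hq : quadform q).

Lemma quadform0 : q 0 = 0.
Proof. by case: hq => _ /(_ 0 0); rewrite scale0r /= expr0n /= addr0 mul0r => ->. Qed.

Lemma quadformN x : q (- x) = q x.
Proof.
by case: hq => _ h; rewrite -scaleN1r h /= oppr0 expr0n /= addr0 sqrrN expr1n mul1r.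
Qed.

Lemma quadformBC x y : q (x - y) = q (y - x).
Proof. by rewrite -quadformN opprB. Qed.

Lemma polarC x y : polar q x y = polar q y x.
Proof. by rewrite /polar (addrC x) quadformBC. Qed.

Lemma polar0l y : polar q 0 y = 0.
Proof. by rewrite /polar add0r sub0r quadformN subrr mul0r. Qed.

(** Subtract the parallelogram laws for the pairs [(x + z, y)] and [(x - z, y)]. *)
Lemma polarDB x y z : polar q (x + y) z + polar q (x - y) z = 2 * polar q x z.
Proof.
case: hq => hp _; have h1 := hp (x + z) y; have h2 := hp (x - z) y.
rewrite /polar -!(addrAC x z) -!(addrAC x (- z)); lra.
Qed.

Lemma polarDl x y z : polar q (x + y) z = polar q x z + polar q y z.
Proof.
have d u : polar q (u + u) z = 2 * polar q u z.
  by have := polarDB u u z; rewrite subrr polar0l addr0.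
have := polarDB (x + y) (x - y) z.
have -> : x + y + (x - y) = x + x by rewrite addrACA subrr addr0.
have -> : x + y - (x - y) = y + y by rewrite opprB addrC addrA subrK.
by rewrite !d; lra.
Qed.

Lemma quadformD x y : q (x + y) = q x + 2 * polar q x y + q y.
Proof. by case: hq => hp _; have := hp x y; rewrite /polar; lra. Qed.

Lemma polarxx x : polar q x x = q x.
Proof.
have := quadformD x (- x); have -> : polar q x (- x) = - polar q x x.
  by rewrite /polar opprK; lra.
by rewrite subrr quadform0 quadformN; lra.
Qed.

Lemma quadformZ (t : R) x : q (t%:C%C *: x) = t ^+ 2 * q x.
Proof. by case: hq => _ h; rewrite h /= expr0n /= addr0. Qed.

Hypothesis q_ge0 : forall x, 0 <= q x.

(** The proof does not rest on real linearity of [polar], so this can supply the boundedness used in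
    [polarZl]; Cauchy-Schwarz comes afterwards. *)
Lemma norm_polar_le x y : 2 * `|polar q x y| <= q x + q y.
Proof.
have h1 := q_ge0 (x + y); rewrite quadformD in h1.
have h2 := q_ge0 (x - y); rewrite quadformD quadformN in h2.
have h3 : polar q x (- y) = - polar q x y by rewrite /polar opprK; lra.
rewrite h3 in h2; have [_|_] := ger0P (polar q x y); lra.
Qed.

(* An additive function of t that is bounded on [0, 1] is linear. *)
Lemma polarZl (t : R) x y : polar q (t%:C%C *: x) y = t * polar q x y.
Proof.
pose f t := polar q (t%:C%C *: x) y - t * polar q x y.
have fD s u : f (s + u) = f s + f u.
  by rewrite /f rmorphD scalerDl polarDl; ring.
have f0 : f 0 = 0 by rewrite /f scale0r polar0l mul0r subrr.
have f1 : f 1 = 0 by rewrite /f scale1r mul1r subrr.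
have fn n s : f (n%:R * s) = n%:R * f s.
  elim: n => [|n ih]; first by rewrite !mul0r f0.
  by rewrite -natr1 !mulrDl !mul1r fD ih.
pose C := (q x + q y) + `|polar q x y|.
have bnd r : 0 <= r <= 1 -> `|f r| <= C.
  move=> /andP[r0 r1]; apply: le_trans (ler_normB _ _) _; apply: lerD.
    have := norm_polar_le (r%:C%C *: x) y; rewrite quadformZ.
    have := q_ge0 x; have := q_ge0 y.
    have : r ^+ 2 * q x <= q x by rewrite ler_piMl ?exprn_ile1.
    have := normr_ge0 (polar q (r%:C%C *: x) y); lra.
  by rewrite normrM (ger0_norm r0) ler_piMl.
have C0 : 0 <= C by apply: le_trans (bnd 0 _); rewrite ?normr_ge0 ?lexx ?ler01.
have pos s : 0 <= s -> f s = 0.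
  move=> s0; apply/normr0_eq0/eqP; rewrite eq_le normr_ge0 andbT leNgt; apply/negP => hs.
  (* For this [n], [n |f s|] exceeds [C]; removing the integer part [m] of [n s] leaves [f]
     unchanged but moves the argument into [[0, 1]]. *)
  pose n := (Num.truncn (C / `|f s|)).+1.
  have hn : C < n%:R * `|f s| by rewrite -ltr_pdivrMr // truncnS_gt.
  have ns0 : 0 <= n%:R * s by rewrite mulr_ge0 ?ler0n.
  pose m := Num.truncn (n%:R * s).
  have /andP[m1 m2] : m%:R <= n%:R * s < m.+1%:R by rewrite truncn_itv.
  have : f (n%:R * s) = f (n%:R * s - m%:R).
    rewrite -{1}(subrK m%:R (n%:R * s)) fD -(mulr1 m%:R) fn f1; ring.
  rewrite fn => e; have := bnd (n%:R * s - m%:R).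
  rewrite -e normrM normr_nat subr_ge0 m1 /= => /(_ _) h.
  have : n%:R * `|f s| <= C by apply: h; rewrite -natr1 in m2; lra.
  by rewrite leNgt hn.
suff : f t = 0 by rewrite /f; lra.
have [/pos //|t0] := leP 0 t.
have := fD t (- t); rewrite subrr f0 (pos (- t)); lra.
Qed.

Lemma polarZr (t : R) x y : polar q x (t%:C%C *: y) = t * polar q x y.
Proof. by rewrite polarC polarZl polarC. Qed.

Lemma polar_iZl x y : polar q ('i%C *: x) y = - polar q x ('i%C *: y).
Proof.
case: hq => _ h; have hi z : q ('i%C *: z) = q z by rewrite h /= expr0n expr1n /= add0r mul1r.
have i2 : 'i%C * 'i%C = -1 :> R[i] by rewrite -expr2 sqr_i.
rewrite /polar -(hi (x + _)) -(hi (x - _)) scalerDr scalerBr !scalerA i2 scaleN1r opprK.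
lra.
Qed.

(** Split [c] into real and imaginary parts; multiplication by [i] preserves [q], hence passes to
    the other argument with a sign. *)
Lemma polarZZ (c : R[i]) x y : polar q (c *: x) y = polar q x ((c^*)%C *: y).
Proof.
have e (d : R[i]) (z : V) : d *: z = (complex.Re d)%:C%C *: z
    + (complex.Im d)%:C%C *: ('i%C *: z).
  by rewrite {1}(complexE d) scalerDl scalerA mulrC.
rewrite (e c) (e _ y) polarDl (polarC x) polarDl !polarZl !(polarC _ x) polar_iZl.
by case: c => a b /=; ring.
Qed.

Lemma polar_sqr_le x y : polar q x y ^+ 2 <= q x * q y.
Proof.
have key (t : R) : 0 <= t ^+ 2 * q x + 2 * t * polar q x y + q y.
  by have := q_ge0 (t%:C%C *: x + y); rewrite quadformD quadformZ polarZl; lra.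
have [x0|x0] := eqVneq (q x) 0.
  have [->|b0] := eqVneq (polar q x y) 0; first by rewrite x0 expr0n mul0r.
  (* With [q x = 0] the expression in [key] is affine in [t], and at this [t] it equals [-1]. *)
  have := key (- (q y + 1) / (2 * polar q x y)); rewrite x0 mulr0 add0r.
  have -> : 2 * (- (q y + 1) / (2 * polar q x y)) * polar q x y = - (q y + 1) by field.
  lra.
have xp : 0 < q x by rewrite lt_def x0 q_ge0.
have := key (- polar q x y / q x).
have -> : (- polar q x y / q x) ^+ 2 * q x + 2 * (- polar q x y / q x) * polar q x y
   + q y = (q x * q y - polar q x y ^+ 2) / q x by field.
by rewrite pmulr_lge0 ?invr_gt0 // subr_ge0.
Qed.

End QuadraticForm.

Lemma quadform_hnorm {R : realType} {H : lmodType R[i]} {ip : H -> H -> R[i]} :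
  is_inner_product ip -> quadform (fun x => hnorm ip x ^+ 2).
Proof. by move=> hip; split => *; [rewrite hn_parallelogram | rewrite hnZ2]. Qed.

(** * From a bounded quadratic form to an operator *)

Section Operators.
Context {R : realType} {H : lmodType R[i]} {ip : H -> H -> R[i]}.
Hypothesis hH : is_hilbert ip.
Let hip : is_inner_product ip := hH.1.
Let hcomp : hilbert_complete ip := hH.2.

Local Notation hn := (hnorm ip).
Local Notation ipr := (@ipr _ _ ip).

(* The representing vector minimises [|y|^2 - 2 f y]. *)
Lemma riesz (f : H -> R) (c : R) :
  (forall x y, f (x + y) = f x + f y) -> (forall (t : R) x, f (t%:C%C *: x) = t * f x) ->
  (forall x, `|f x| <= c * hn x) ->
  exists z, forall y, ipr z y = f y.
Proof.
move=> fD fZ fb.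
pose F y := hn y ^+ 2 - 2 * f y.
have FD z y (t : R) : F (z + t%:C%C *: y) =
    F z + 2 * t * (ipr z y - f y) + t ^+ 2 * hn y ^+ 2.
  by rewrite /F hnD2 // iprZr // fD fZ hnZ // exprMn real_normK ?num_real //; ring.
have Fb y : - c ^+ 2 <= F y.
  have := fb y; have := ler_norm (f y); have := sqr_ge0 (hn y - c).
  rewrite /F sqrrB; lra.
pose I := inf (range F).
have hI : has_inf (range F).
  split; first by exists (F 0), 0.
  by exists (- c ^+ 2) => _ [y _ <-].
have Ile y : I <= F y by apply: ge_inf; [case: hI | exists y].
have [u hu] : exists u : nat -> H, forall n, F (u n) < I + (4^-1) ^+ n.
  have [|u hu] := @boolp.choice nat H (fun n y => F y < I + (4^-1) ^+ n); last by exists u.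
  move=> n; have [|_ [y _ <-] hy] := inf_adherent (eps := (4^-1) ^+ n) _ hI.
    by rewrite exprn_gt0.
  by exists y.
(* By the parallelogram law and the midpoint, two points within [4^-n] of the infimum have squared
   distance of order [4^-n]. *)
have hc n : hn (u n.+1 - u n) <= 2 * (2^-1) ^+ n.
  have e4 : (4^-1 : R) ^+ n = ((2^-1) ^+ n) ^+ 2 by rewrite -exprM mulnC exprM; congr (_ ^+ _); field.
  rewrite -(ler_pXn2r (n := 2)) ?nnegrE ?hn_ge0 ?mulr_ge0 ?exprn_ge0 //.
  have := hu n; have := hu n.+1; rewrite exprS exprMn -e4.
  have := exprn_ge0 n (_ : 0 <= 4^-1 :> R); rewrite invr_ge0 ler0n => /(_ isT).
  have := Ile (2^-1%:C%C *: (u n + u n.+1)); rewrite /F fZ fD hnZ // exprMn.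
  rewrite real_normK ?num_real //.
  have := hn_parallelogram hip (u n.+1) (u n); rewrite (addrC (u n.+1) (u n)).
  set p4 := 4^-1 ^+ n; rewrite expr2; lra.
have [z hz] := geom_cauchy hip u (2^-1) 2 hcomp ltac:(lra) ltac:(lra) hc.
have Fz : F z <= I.
  rewrite -subr_le0.
  apply: (le_geom_eq0 (2^-1) _ (2 * (`|c| + hn z) * 4 + 1 )); [lra|lra|] => n.
  have e4 : (4^-1 : R) ^+ n <= (2^-1) ^+ n by apply: lerXn2r; rewrite ?nnegrE; lra.
  have hzn := hz n; have hun := hu n.
  have c4 : 2 / (1 - 2^-1) = 4 :> R by field.
  rewrite c4 in hzn.
  have h1 : F z - F (u n) <= 2 * (`|c| + hn z) * hn (u n - z).
    have -> : F (u n) = F (z + 1%:C%C *: (u n - z)) by rewrite scale1r addrC subrK.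
    rewrite (FD z _ 1).
    have := ipr_le_hnorm hip z (z - u n); have := fb (u n - z).
    have := ler_norm (f (u n - z)); rewrite (hnBC hip z) -(opprB (u n)) (iprNr hip).
    have : c * hn (u n - z) <= `|c| * hn (u n - z).
      by rewrite ler_wpM2r ?hn_ge0 // ler_norm.
    have := sqr_ge0 (hn (u n - z)); lra.
  have h2 : 2 * (`|c| + hn z) * hn (u n - z) <= 2 * (`|c| + hn z) * (4 * 2^-1 ^+ n).
    apply: ler_wpM2l; first by rewrite mulr_ge0 // addr_ge0 ?hn_ge0.
    exact: hzn.
  lra.
exists z => y.
have key t : 0 <= 2 * t * (ipr z y - f y) + t ^+ 2 * hn y ^+ 2.
  have := Ile (z + t%:C%C *: y); rewrite FD; lra.
(* The denominator [1 + |y|^2] also covers [y = 0]; the quadratic becomes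
   [- d^2 (2 + s) / (1 + s)^2]. *)
have := key (- (ipr z y - f y) / (1 + hn y ^+ 2)).
set d := ipr z y - f y; set s := hn y ^+ 2 => h.
have s0 : 0 <= s by exact: sqr_ge0.
have : 0 <= - d ^+ 2 * (2 + s) / (1 + s) ^+ 2.
  apply: le_trans h _; rewrite le_eqVlt; apply/orP; left; apply/eqP.
  by field; lra.
rewrite pmulr_lge0 ?invr_gt0 ?exprn_gt0 ?ltr_pwDl // mulNr oppr_ge0 pmulr_lle0; last lra.
move=> d2; have : d ^+ 2 == 0 by rewrite eq_le d2 sqr_ge0.
by rewrite sqrf_eq0 /d subr_eq0 => /eqP.
Qed.

(** Riesz represents [y |-> polar q x y], bounded by Cauchy-Schwarz. Complex linearity in [x]
    follows since real pairings separate vectors and [polarZZ] moves scalars across. *)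
Lemma quadform_operator (q : H -> R) (th : R) : 0 <= th -> quadform q ->
  (forall x, 0 <= q x) -> (forall x, q x <= th * hn x ^+ 2) ->
  exists A : H -> H, [/\ linop A, forall x y, ipr (A x) y = polar q x y &
    forall x, hn (A x) <= th * hn x].
Proof.
move=> th0 hq q0 qth.
have pb x y : `|polar q x y| <= th * hn x * hn y.
  rewrite -(ler_pXn2r (n := 2)) ?nnegrE ?normr_ge0 ?mulr_ge0 ?hn_ge0 //.
  rewrite real_normK ?num_real //; apply: le_trans (polar_sqr_le hq q0 x y) _.
  have -> : (th * hn x * hn y) ^+ 2 = (th * hn x ^+ 2) * (th * hn y ^+ 2) by ring.
  exact: ler_pM.
have [A hA] : exists A : H -> H, forall x y, ipr (A x) y = polar q x y.
  have [|A hA] := @boolp.choice H H (fun x z => forall y, ipr z y = polar q x y);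
    last by exists A.
  move=> x.
  apply: (riesz _ (th * hn x)) => //.
  - by move=> y z; rewrite !(polarC hq x) (polarDl hq).
  - by move=> t y; rewrite (polarZr hq q0).
exists A; split => //.
  move=> a x y; apply: (ipr_inj hip) => z.
  rewrite hA (polarDl hq) (polarZZ hq q0) -!hA (iprDl hip); congr (_ + _).
  by rewrite -(iprZZ hip).
move=> x; have [->|h] := eqVneq (hn (A x)) 0; first by rewrite mulr_ge0 ?hn_ge0.
have hp : 0 < hn (A x) by rewrite lt_def h hn_ge0.
rewrite -(ler_pM2r hp) -expr2 hn2 // hA.
exact: le_trans (ler_norm _) (pb _ _).
Qed.

(** The equation [2 Y = A + Y^2] says [(1 - Y)^2 = 1 - A]. It is solved by iterating
    [Z |-> (A + Z^2) / 2] from 0; the bound [1 - e] is preserved because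
    [(1 - e^2) + (1 - e)^2 = 2 (1 - e)]. *)
Lemma symmetric_sqrt (A : H -> H) (e : R) : 0 < e -> e <= 1 -> linop A ->
  (forall x y, ipr (A x) y = ipr x (A y)) ->
  (forall x, hn (A x) <= (1 - e ^+ 2) * hn x) ->
  exists Y : H -> H, [/\ linop Y, forall x y, ipr (Y x) y = ipr x (Y y),
    forall x, hn (Y x) <= (1 - e) * hn x & forall x, Y x + Y x = A x + Y (Y x)].
Proof.
move=> e0 e1 lA sA bA.
pose h : R[i] := (2^-1)%:C%C.
pose step (Z : H -> H) x := h *: (A x + Z (Z x)).
pose Y n := iter n step (fun _ => 0).
have lY n : linop (Y n).
  elim: n => [|n ih] a x y /=; first by rewrite scaler0 addr0.
  by rewrite /step lA !ih !scalerDr !scalerA (mulrC h a) addrACA.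
have sY n x y : ipr (Y n x) y = ipr x (Y n y).
  elim: n x y => [|n ih] x y /=; first by rewrite (ipr0l hip) (iprC hip) (ipr0l hip).
  by rewrite /step (iprZl hip) (iprZr hip) (iprDl hip) (iprDr hip) sA !ih.
have bY n x : hn (Y n x) <= (1 - e) * hn x.
  elim: n x => [|n ih] x /=; first by rewrite (hn0 hip) mulr_ge0 ?hn_ge0 // subr_ge0.
  rewrite /step (hnZ hip) ger0_norm ?invr_ge0 //.
  have := hnD hip (A x) (Y n (Y n x)); have := bA x; have := ih (Y n x).
  have : (1 - e) * hn (Y n x) <= (1 - e) * ((1 - e) * hn x).
    by apply: ler_wpM2l => //; rewrite subr_ge0.
  rewrite !mulrBl !mul1r expr2; lra.
have dY n x : hn (Y n.+1 x - Y n x) <= hn x * (1 - e) ^+ n.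
  elim: n x => [|n ih] x.
    rewrite /= /step subr0 addr0 (hnZ hip) ger0_norm ?invr_ge0 // expr0.
    have := bA x; have := hn_ge0 (ip := ip) x.
    have : 0 <= e ^+ 2 * hn x by rewrite mulr_ge0 ?sqr_ge0 ?hn_ge0.
    rewrite mulrBl; lra.
  (* The difference of the two squares is split without commuting factors; the induction hypothesis
     serves at [x] and at [Y n x]. *)
  have -> : Y n.+2 x - Y n.+1 x =
      h *: (Y n.+1 (Y n.+1 x - Y n x) + (Y n.+1 (Y n x) - Y n (Y n x))).
    rewrite (linopB _ _ (Y n.+1) (lY n.+1)) addrA subrK.
    by rewrite [in LHS]/Y !iterS -/(Y n) -/(Y n.+1) /step -scalerBr opprD addrACA subrr add0r.
  rewrite (hnZ hip) ger0_norm ?invr_ge0 //.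
  have h1 := hnD hip (Y n.+1 (Y n.+1 x - Y n x)) (Y n.+1 (Y n x) - Y n (Y n x)).
  have h2 := bY n.+1 (Y n.+1 x - Y n x).
  have h3 : (1 - e) * hn (Y n.+1 x - Y n x) <= (1 - e) * (hn x * (1 - e) ^+ n).
    by apply: ler_wpM2l; rewrite ?subr_ge0.
  have h4 := ih (Y n x).
  have h5 : hn (Y n x) * (1 - e) ^+ n <= (1 - e) * hn x * (1 - e) ^+ n.
    by apply: ler_wpM2r; rewrite ?exprn_ge0 ?subr_ge0.
  rewrite exprS; move: h1 h2 h3 h4 h5; set p := (1 - e) ^+ n; lra.
have y0 : 0 <= 1 - e by rewrite subr_ge0.
have y1 : 1 - e < 1 by rewrite ltrBlDr ltrDl.
have [Z hZ] : exists Z : H -> H, forall x n, hn (Y n x - Z x) <= hn x / e * (1 - e) ^+ n.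
  have [|Z hZ] := @boolp.choice H H
    (fun x z => forall n, hn (Y n x - z) <= hn x / e * (1 - e) ^+ n); last by exists Z.
  move=> x; have [z hz] := geom_cauchy hip (fun n => Y n x) _ _ hcomp y0 y1 (fun n => dY n x).
  by exists z => n; have := hz n; rewrite opprB addrCA subrr addr0.
have bZ x : hn (Z x) <= (1 - e) * hn x.
  rewrite -subr_le0; apply: (le_geom_eq0 _ _ (hn x / e) y0 y1) => n.
  have := hnD hip (Y n x) (Z x - Y n x); rewrite addrCA subrr addr0 (hnBC hip (Z x)).
  have := hZ x n; have := bY n x; lra.
exists Z; split => //.
- move=> a x y; apply/eqP; rewrite -subr_eq0; apply/eqP/(hn0_eq0 hip)/eqP.
  rewrite eq_le (hn_ge0 (ip := ip)) andbT.
  set ca := hn (a *: x + y) / e + Num.sqrt (complex.Re a ^+ 2 + complex.Im a ^+ 2) * (hn x / e) + hn y / e.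
  apply: (le_geom_eq0 _ _ ca y0 y1) => n.
  have -> : Z (a *: x + y) - (a *: Z x + Z y) =
     (Z (a *: x + y) - Y n (a *: x + y)) + (a *: (Y n x - Z x) + (Y n y - Z y)).
    by rewrite lY scalerBr (addrACA (a *: Y n x)) -opprD addrA subrK.
  apply: le_trans (hnD hip _ _) _; rewrite (hnBC hip (Z _)).
  have h1 := hZ (a *: x + y) n.
  have h2 := hnD hip (a *: (Y n x - Z x)) (Y n y - Z y).
  have h3 := hZ y n.
  have h4 : hn (a *: (Y n x - Z x)) <= Num.sqrt (complex.Re a ^+ 2 + complex.Im a ^+ 2) * (hn x / e * (1 - e) ^+ n).
    rewrite -[leLHS]ger0_norm ?hn_ge0 // -sqrtr_sqr (hnZ2 hip) sqrtrM ?addr_ge0 ?sqr_ge0 // sqrtr_sqr.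
    by rewrite ger0_norm ?hn_ge0 // ler_wpM2l ?sqrtr_ge0.
  move: h1 h2 h3 h4; rewrite /ca; set p := (1 - e) ^+ n; lra.
- move=> x y; apply/eqP; rewrite -subr_eq0 -normr_eq0 eq_le normr_ge0 andbT.
  apply: (le_geom_eq0 _ _ (hn x / e * hn y + hn x * (hn y / e)) y0 y1) => n.
  have -> : ipr (Z x) y - ipr x (Z y) = - ipr (Y n x - Z x) y + ipr x (Y n y - Z y).
    by rewrite (iprDl hip) (iprNl hip) (iprDr hip) (iprNr hip) sY; ring.
  have CS u v : `|ipr u v| <= hn u * hn v.
    have := ipr_le_hnorm hip u v; have := ipr_le_hnorm hip (- u) v.
    by rewrite (hnN hip) (iprNl hip) ler_norml => *; apply/andP; split; lra.
  apply: le_trans (ler_normD _ _) _; rewrite normrN.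
  have h1 := CS (Y n x - Z x) y; have h2 := CS x (Y n y - Z y).
  have h3 : hn (Y n x - Z x) * hn y <= hn x / e * (1 - e) ^+ n * hn y.
    by rewrite ler_wpM2r ?hn_ge0.
  have h4 : hn x * hn (Y n y - Z y) <= hn x * (hn y / e * (1 - e) ^+ n).
    by rewrite ler_wpM2l ?hn_ge0.
  move: h1 h2 h3 h4; set p := (1 - e) ^+ n; lra.
- move=> x; apply/eqP; rewrite -subr_eq0; apply/eqP/(hn0_eq0 hip)/eqP.
  rewrite eq_le (hn_ge0 (ip := ip)) andbT.
  apply: (le_geom_eq0 _ _ (4 * (hn x / e) + hn (Z x) / e) y0 y1) => n.
  have Yn1 : Y n.+1 x + Y n.+1 x = A x + Y n (Y n x).
    have hh : h + h = 1.
      by rewrite /h -rmorphD /=; have -> : 2^-1 + 2^-1 = 1 :> R by field.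
    by rewrite [Y n.+1]/= /step -scalerDl hh scale1r.
  (* The recursion [Yn1] cancels [A], leaving differences of iterates and limit, all geometrically
     small. *)
  have -> : Z x + Z x - (A x + Z (Z x)) = (Z x - Y n.+1 x) + ((Z x - Y n.+1 x) +
      (Y n (Y n x - Z x) + (Y n (Z x) - Z (Z x)))).
    rewrite (linopB _ _ (Y n) (lY n)) (addrA (Y n (Y n x) - _)) subrK.
    rewrite addrA (addrACA (Z x)) -opprD Yn1 -[RHS]addrA; congr (_ + _).
    by rewrite !opprD addrA subrK.
  apply: le_trans (hnD hip _ _) _; apply: le_trans (lerD (lexx _) (hnD hip _ _)) _.
  apply: le_trans (lerD (lexx _) (lerD (lexx _) (hnD hip _ _))) _.
  rewrite !(hnBC hip (Z x)).
  have h1 := hZ x n.+1; rewrite exprS in h1.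
  have h2 := bY n (Y n x - Z x).
  have h3 := hZ x n; have h4 := hZ (Z x) n.
  have h5 : (1 - e) * hn (Y n x - Z x) <= hn (Y n x - Z x).
    by rewrite ler_piMl ?hn_ge0 // ltW.
  have h6 : hn x / e * ((1 - e) * (1 - e) ^+ n) <= hn x / e * (1 - e) ^+ n.
    by rewrite ler_wpM2l ?divr_ge0 ?hn_ge0 ?(ltW e0) // ler_piMl ?exprn_ge0 // ltW.
  have h7 : 0 <= hn x / e * (1 - e) ^+ n by rewrite !mulr_ge0 ?exprn_ge0 ?invr_ge0 ?hn_ge0 // ltW.
  move: h1 h2 h3 h4 h5 h6 h7; set p := (1 - e) ^+ n; lra.
Qed.

End Operators.

Lemma subrACA (V : zmodType) (a b c d : V) : a - b - (c - d) = a - c - (b - d).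
Proof. by rewrite !opprD !opprK addrACA. Qed.

(** * Equivalent quadratic forms as squared norms of invertible operators *)

Section Renorm.
Context {R : realType} {H : lmodType R[i]} {ip : H -> H -> R[i]}.
Hypothesis hH : is_hilbert ip.
Let hip : is_inner_product ip := hH.1.
Let hcomp : hilbert_complete ip := hH.2.

Local Notation hn := (hnorm ip).
Local Notation ipr := (@ipr _ _ ip).

(** Iterating [w |-> z + Y w] from 0 runs through the partial sums of the Neumann series.
    Injectivity of [1 - Y] makes the chosen solutions linear in [z] and yields the left inverse. *)
Lemma neumann (Y : H -> H) (y : R) : 0 <= y -> y < 1 -> linop Y ->
  (forall x, hn (Y x) <= y * hn x) ->
  exists Z : H -> H, [/\ bounded_op ip Z, forall x, Z x - Y (Z x) = x &
    forall x, Z (x - Y x) = x].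
Proof.
move=> y0 y1 lY bY; have y1' : 0 < 1 - y by lra.
have sol z : exists w, w - Y w = z.
  pose w n := iter n (fun w => z + Y w) 0.
  have hw n : hn (w n.+1 - w n) <= hn z * y ^+ n.
    elim: n => [|n ih]; first by rewrite /= (linop0 _ _ _ lY) addr0 subr0 expr0 mulr1.
    have -> : w n.+2 - w n.+1 = Y (w n.+1 - w n).
      by rewrite (linopB _ _ _ lY) /= opprD addrACA subrr add0r.
    apply: le_trans (bY _) _; rewrite exprS.
    by have := ler_wpM2l y0 ih; rewrite mulrCA.
  have [l hl] := geom_cauchy hip _ _ _ hcomp y0 y1 hw.
  exists l; apply/eqP; rewrite -subr_eq0; apply/eqP/(hn0_eq0 hip)/eqP.
  rewrite eq_le (hn_ge0 (ip := ip)) andbT.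
  apply: (le_geom_eq0 _ _ (2 * (hn z / (1 - y))) y0 y1) => n.
  have -> : l - Y l - z = - (w n.+1 - l) + Y (w n - l).
    by rewrite (linopB _ _ _ lY) /= opprB opprD (addrA l) (addrA (l - z - _)) subrK addrAC.
  apply: le_trans (hnD hip _ _) _; rewrite hnN //.
  have h1 := hl n.+1; have h2 := hl n; have h3 := bY (w n - l).
  have h4 : y * hn (w n - l) <= hn (w n - l) by rewrite ler_piMl ?hn_ge0 // ltW.
  have h5 : hn z / (1 - y) * y ^+ n.+1 <= hn z / (1 - y) * y ^+ n.
    by rewrite ler_wpM2l ?divr_ge0 ?hn_ge0 ?(ltW y1') // exprS ler_piMl ?exprn_ge0 // ltW.
  lra.
have inj u : u - Y u = 0 -> u = 0.
  move=> /eqP; rewrite subr_eq0 => /eqP e; apply: (hn0_eq0 hip); apply/eqP.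
  rewrite eq_le hn_ge0 andbT; have := bY u; rewrite -e => h.
  by rewrite -(pmulr_rle0 _ y1') mulrBl mul1r subr_le0.
have [|Z hZ] := @boolp.choice H H (fun z w => w - Y w = z); first exact: sol.
have lZ : linop Z.
  move=> a u v; apply/eqP; rewrite -subr_eq0; apply/eqP/inj.
  rewrite (linopB _ _ _ lY) lY subrACA hZ (opprD (a *: Y _)).
  by rewrite (addrACA (a *: Z u)) -scalerBr !hZ subrr.
exists Z; split => //.
- split => //; exists (1 - y)^-1 => x.
  rewrite ler_pdivlMl // mulrBl mul1r lerBlDr.
  rewrite -{1}(subrK (Y (Z x)) (Z x)); apply: le_trans (hnD hip _ _) _.
  by rewrite hZ lerD2l.
- move=> x; apply/eqP; rewrite -subr_eq0; apply/eqP/inj.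
  by rewrite (linopB _ _ _ lY) subrACA hZ subrr.
Qed.

(** Let [A] represent [a = |.|^2 - q / k], which lies between 0 and [(1 - k^-2) |.|^2]. With
    [(1 - Y)^2 = 1 - A], the operator [sqrt k (1 - Y)] has squared norm [k (|x|^2 - a x) = q x] at
    [x]; as [|Y| <= 1 - 1 / k], [neumann] inverts it. *)
Lemma quadform_renorm (q : H -> R) (k : R) : 1 <= k -> quadform q ->
  (forall x, hn x ^+ 2 <= k * q x) -> (forall x, q x <= k * hn x ^+ 2) ->
  exists Rop Rinv, invertible_pair ip Rop Rinv /\ forall x, hn (Rop x) ^+ 2 = q x.
Proof.
move=> k1 hq q1 q2; have k0 : 0 < k by lra.
pose a x := hn x ^+ 2 - k^-1 * q x.
have ha : quadform a.
  case: hq (quadform_hnorm hip) => p1 p2 [p3 p4]; split => [x y|c x]; rewrite /a.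
    have e : k^-1 * q (x + y) + k^-1 * q (x - y) = 2 * (k^-1 * q x + k^-1 * q y).
      by rewrite -mulrDr p1; ring.
    by have := p3 x y => /=; lra.
  by rewrite p2 p4; ring.
have a0 x : 0 <= a x by rewrite subr_ge0 ler_pdivrMl.
have ki : 0 < k^-1 by rewrite invr_gt0.
have ki1 : k^-1 <= 1 by rewrite invf_le1.
have ki2 : k^-1 ^+ 2 <= 1 by rewrite exprn_ile1 // ltW.
have ale x : a x <= (1 - k^-1 ^+ 2) * hn x ^+ 2.
  have : k^-1 * hn x ^+ 2 <= q x by rewrite ler_pdivrMl.
  rewrite -(ler_pM2l ki); rewrite /a mulrBl mul1r expr2; lra.
have th0 : 0 <= 1 - k^-1 ^+ 2 by rewrite subr_ge0.
have [A [lA pA bA]] := quadform_operator hH a _ th0 ha a0 ale.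
have sA x y : ipr (A x) y = ipr x (A y) by rewrite (iprC hip x) !pA (polarC ha).
have [Y [lY sY bY eY]] := symmetric_sqrt hH A _ ki ki1 lA sA bA.
have y0 : 0 <= 1 - k^-1 by rewrite subr_ge0.
have y1 : 1 - k^-1 < 1 by rewrite ltrBlDr ltrDl.
have [Z [[lZ [c bZ]] eZ1 eZ2]] := neumann Y _ y0 y1 lY bY.
have sk : 0 < Num.sqrt k by rewrite sqrtr_gt0.
pose s : R[i] := (Num.sqrt k)%:C%C.
pose s' : R[i] := (Num.sqrt k)^-1%:C%C.
have ss : s' * s = 1 by rewrite /s /s' -rmorphM /= mulVf ?rmorph1 // gt_eqF.
have lX : linop (fun x => x - Y x).
  by move=> b x y; rewrite lY opprD addrACA scalerBr.
exists (fun x => s *: (x - Y x)), (fun x => Z (s' *: x)); split.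
- split; [|split; [|split]].
  + split; first by move=> b x y; rewrite lX scalerDr !scalerA mulrC.
    exists (Num.sqrt k * 2) => x; rewrite (hnZ hip) ger0_norm ?(ltW sk) // -mulrA.
    rewrite ler_pM2l //; apply: le_trans (hnD hip _ _) _; rewrite (hnN hip).
    have := bY x; have : k^-1 * hn x >= 0 by rewrite mulr_ge0 ?hn_ge0 // ltW.
    rewrite mulrBl mul1r; have := hn_ge0 (ip := ip) x; lra.
  + split; first by move=> b x y; rewrite scalerDr scalerA mulrC -scalerA lZ.
    exists (c * (Num.sqrt k)^-1) => x; apply: le_trans (bZ _) _.
    by rewrite (hnZ hip) ger0_norm ?invr_ge0 ?sqrtr_ge0 // mulrA.
  + by move=> x; rewrite eZ1 scalerA mulrC ss scale1r.
  + by move=> x; rewrite scalerA ss scale1r eZ2.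
- move=> x; rewrite (hnZ hip) exprMn real_normK ?num_real // sqr_sqrtr ?(ltW k0) //.
  rewrite (hnD2 hip) (hnN hip) (iprNr hip) [in X in _ + X](hn2 hip) sY.
  have := congr1 (ipr x) (eY x); rewrite !(iprDr hip) -sA pA (polarxx ha) /a => e.
  have -> : hn x ^+ 2 + 2 * - ipr x (Y x) + ipr x (Y (Y x)) = k^-1 * q x by lra.
  by rewrite mulrA mulfV ?mul1r // gt_eqF.
Qed.

(** * Estimates with the operator norm *)

Lemma opnorm_le (f : H -> H) (c : R) : 0 <= c ->
  (forall x, hn (f x) <= c * hn x) -> opnorm ip f <= c.
Proof.
move=> c0 h; apply: ge_sup.
  by exists (hn (f 0)), 0 => //=; rewrite (hn0 hip).
by move=> _ [x /= x1 <-]; apply: le_trans (h x) _; rewrite ler_piMr.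
Qed.

Lemma le_opnorm (f : H -> H) x : bounded_op ip f -> hn (f x) <= opnorm ip f * hn x.
Proof.
move=> [lf [c hc]]; have [h|h] := eqVneq (hn x) 0.
  by rewrite (hn0_eq0 hip x h) (linop0 _ _ f lf) (hn0 hip) mulr0.
have hp : 0 < hn x by rewrite lt_def h hn_ge0.
rewrite -ler_pdivrMr //.
have -> : hn (f x) / hn x = hn (f ((hn x)^-1%:C%C *: x)).
  by rewrite (linopZ _ _ f lf) (hnZ hip) ger0_norm ?invr_ge0 ?hn_ge0 // mulrC.
apply: ub_le_sup.
  exists `|c| => _ [z /= z1 <-]; apply: le_trans (hc z) _.
  apply: le_trans (ler_wpM2r (hn_ge0 z) (ler_norm c)) _.
  by rewrite ler_piMr.
by exists ((hn x)^-1%:C%C *: x) => //=; rewrite (hnZ hip) ger0_norm ?invr_ge0 ?hn_ge0 // mulVf.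
Qed.

Lemma opnorm_ge0 (f : H -> H) : bounded_op ip f -> 0 <= opnorm ip f.
Proof.
move=> [lf [c hc]]; apply: ub_le_sup.
  exists `|c| => _ [z /= z1 <-]; apply: le_trans (hc z) _.
  apply: le_trans (ler_wpM2r (hn_ge0 z) (ler_norm c)) _.
  by rewrite ler_piMr.
by exists 0; rewrite /= ?(linop0 _ _ f lf) (hn0 hip).
Qed.

End Renorm.

(** * The discretised problem *)

Section QuadformClosure.
Context {R : realType}.

Lemma quadform_comp {V W : lmodType R[i]} (Q : W -> R) (f : V -> W) :
  linop f -> quadform Q -> quadform (fun x => Q (f x)).
Proof.
move=> lf [h1 h2]; split => [x y|c x].
  by rewrite (linopD _ _ f lf) (linopB _ _ f lf).
by rewrite (linopZ _ _ f lf).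
Qed.

Lemma quadform_scale {V : lmodType R[i]} (a : R) (Q : V -> R) :
  quadform Q -> quadform (fun x => a * Q x).
Proof.
move=> [h1 h2]; split => [x y|c x]; first by rewrite -mulrDr h1; ring.
by rewrite h2; ring.
Qed.

Lemma quadform_add {V : lmodType R[i]} (P Q : V -> R) :
  quadform P -> quadform Q -> quadform (fun x => P x + Q x).
Proof.
move=> [g1 g2] [h1 h2]; split => [x y|c x]; last by rewrite g2 h2; ring.
by rewrite addrACA g1 h1; ring.
Qed.

Lemma quadform_sum {V : lmodType R[i]} n (Q : 'I_n -> V -> R) :
  (forall i, quadform (Q i)) -> quadform (fun x => \sum_(i < n) Q i x).
Proof.
move=> h; split => [x y|c x].
  rewrite -!big_split big_distrr; apply: eq_bigr => i _; exact: (h i).1.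
by rewrite big_distrr; apply: eq_bigr => i _; exact: (h i).2.
Qed.

(** Think of [r] as a cost of reaching [w]. The parallelogram identity between costs gives one
    inequality between infima; homogeneity turns it into the other. *)
Lemma quadform_inf {V : lmodType R[i]} (P : V -> R -> Prop) :
  (forall w, exists r, P w r) -> (forall w r, P w r -> 0 <= r) ->
  (forall w w' r r', P w r -> P w' r' -> exists s s',
     [/\ P (w + w') s, P (w - w') s' & s + s' = 2 * (r + r')]) ->
  (forall c w r, P w r -> P (c *: w) ((complex.Re c ^+ 2 + complex.Im c ^+ 2) * r)) ->
  quadform (fun w => inf (P w : set R)).
Proof.
move=> Pex P0 PD PZ.
have hlb w : has_lbound (P w : set R) by exists 0 => r /P0.
have hi w : has_inf (P w : set R) by split => //; case: (Pex w) => r; exists r.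
have Zle c w : inf (P (c *: w) : set R) <=
    (complex.Re c ^+ 2 + complex.Im c ^+ 2) * inf (P w : set R).
  set d := _ + _ ^+ 2; have d0 : 0 <= d by rewrite addr_ge0 ?sqr_ge0.
  apply/ler_addgt0Pr => e e0.
  have d1 : 0 < d + 1 by rewrite ltr_wpDl.
  have [r Pr hr] := inf_adherent (eps := e / (d + 1)) (divr_gt0 e0 d1) (hi w).
  apply: le_trans (ge_inf (hlb _) (PZ c _ _ Pr)) _; rewrite -/d.
  apply: le_trans (ler_wpM2l d0 (ltW hr)) _; rewrite mulrDr lerD2l.
  by rewrite mulrA ler_pdivrMr // mulrC ler_pM2l // lerDl.
have Z c w : inf (P (c *: w) : set R) =
    (complex.Re c ^+ 2 + complex.Im c ^+ 2) * inf (P w : set R).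
  have [->|c0] := eqVneq c 0.
    apply/eqP; rewrite eq_le Zle /= expr0n /= addr0 mul0r.
    by apply: lb_le_inf; [case: (hi (0 *: w)) | move=> r /P0].
  apply/eqP; rewrite eq_le Zle /=.
  have := Zle c^-1 (c *: w); rewrite scalerA mulVf // scale1r.
  case: c c0 => a b; rewrite eq_complex negb_and /= => ab.
  have n0 : 0 < a ^+ 2 + b ^+ 2.
    case/orP: ab => h; [rewrite ltr_pwDl|rewrite ltr_wpDl] => //; rewrite ?sqr_ge0 //;
    by rewrite lt_def sqr_ge0 sqrf_eq0 h.
  rewrite -(ler_pM2l n0) mulrA; set g := (X in _ <= X * _ -> _).
  have -> : g = 1 by rewrite /g; field; rewrite gt_eqF.
  by rewrite mul1r.
have le2 w w' : inf (P (w + w') : set R) + inf (P (w - w') : set R) <=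
    2 * (inf (P w : set R) + inf (P w' : set R)).
  apply/ler_addgt0Pr => e e0.
  have e4 : 0 < e / 4 by rewrite divr_gt0.
  have [r Pr hr] := inf_adherent e4 (hi w).
  have [r' Pr' hr'] := inf_adherent e4 (hi w').
  have [s [s' [Ps Ps' ss]]] := PD _ _ _ _ Pr Pr'.
  have := ge_inf (hlb _) Ps; have := ge_inf (hlb _) Ps'; lra.
split => // x y; apply/eqP; rewrite eq_le le2 /=.
have h2 (z : V) : z + z = 2%:R *: z by rewrite scaler_nat mulr2n.
(* The opposite inequality: sum and difference of these vectors are [2 x] and [2 y], where the
   infimum is multiplied by 4. *)
have := le2 (x + y) (x - y).
have -> : x + y + (x - y) = 2%:R *: x by rewrite addrACA subrr addr0 h2.
have -> : x + y - (x - y) = 2%:R *: y by rewrite opprB addrC addrA subrK h2.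
by rewrite !Z /=; lra.
Qed.

End QuadformClosure.

(** * The minimal cost for one fixed time step *)

Section Discrete.
Context {R : realType} {H : lmodType R[i]} {ip : H -> H -> R[i]}.
Hypothesis hip : is_inner_product ip.

Local Notation hn := (hnorm ip).
Local Notation ipr := (@ipr _ _ ip).

(** This is the triangle inequality in the direct sum of [H] and [R]: with [s^2 = c^2 - |b|^2], the
    vector [(b, s)] has norm [c] and equals [(f, s) - (f - b, 0)]. *)
Lemma le_hnormB_sqrt (f b : H) (c : R) : hn b <= c ->
  c <= hn (f - b) + Num.sqrt (hn f ^+ 2 + (c ^+ 2 - hn b ^+ 2)).
Proof.
move=> bc; have b0 := hn_ge0 (ip := ip) b.
have [h|h] := leP c (hn (f - b)).
  by apply: le_trans h _; rewrite lerDl sqrtr_ge0.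
rewrite -lerBlDl -[leLHS]ger0_norm ?subr_ge0 ?(ltW h) // -sqrtr_sqr.
rewrite ler_wsqrtr //.
have e : hn f ^+ 2 = hn (f - b) ^+ 2 + 2 * ipr (f - b) b + hn b ^+ 2.
  by rewrite -hnD2 // subrK.
have := ipr_le_hnorm hip (- (f - b)) b; rewrite hnN // iprNl //.
have := ler_wpM2l (hn_ge0 (ip := ip) (f - b)) bc.
rewrite sqrrB e; lra.
Qed.

(** Cauchy-Schwarz with weights [al, be, be]: [T1] and [T2] stand for squared coefficients divided
    by weights. The cross terms go by AM-GM. *)
Lemma sqr_sum3_le (a1 a2 T1 T2 al be x y z : R) : 0 <= T1 -> 0 <= T2 ->
  0 <= al -> 0 <= be -> a1 ^+ 2 = T1 * al -> a2 ^+ 2 = T2 * be ->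
  (a1 * x + a2 * y + a2 * z) ^+ 2 <=
    (T1 + 2 * T2) * (al * x ^+ 2 + be * (y ^+ 2 + z ^+ 2)).
Proof.
move=> t1 t2 al0 be0 e1 e2.
have amgm (X Y Z : R) : 0 <= X -> 0 <= Y -> Z ^+ 2 = X * Y -> 2 * Z <= X + Y.
  move=> X0 Y0 e; rewrite leNgt; apply/negP => h.
  have := sqr_ge0 (X - Y); have : (X + Y) ^+ 2 < (2 * Z) ^+ 2.
    by rewrite ltr_pXn2r // nnegrE; [rewrite addr_ge0 | apply: le_trans (ltW h); rewrite addr_ge0].
  rewrite sqrrB sqrrD exprMn e; lra.
have h1 : 2 * (a1 * x * (a2 * y)) <= T1 * be * y ^+ 2 + T2 * al * x ^+ 2.
  apply: amgm; [by rewrite mulr_ge0 ?sqr_ge0 ?mulr_ge0|by rewrite mulr_ge0 ?sqr_ge0 ?mulr_ge0|].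
  by rewrite !exprMn e1 e2; ring.
have h2 : 2 * (a1 * x * (a2 * z)) <= T1 * be * z ^+ 2 + T2 * al * x ^+ 2.
  apply: amgm; [by rewrite mulr_ge0 ?sqr_ge0 ?mulr_ge0|by rewrite mulr_ge0 ?sqr_ge0 ?mulr_ge0|].
  by rewrite !exprMn e1 e2; ring.
have h3 : 2 * (a2 * y * (a2 * z)) <= T2 * be * y ^+ 2 + T2 * be * z ^+ 2.
  apply: amgm; [by rewrite mulr_ge0 ?sqr_ge0 ?mulr_ge0|by rewrite mulr_ge0 ?sqr_ge0 ?mulr_ge0|].
  by rewrite !exprMn e2; ring.
have -> : (a1 * x + a2 * y + a2 * z) ^+ 2 = a1 ^+ 2 * x ^+ 2 + a2 ^+ 2 * y ^+ 2
  + a2 ^+ 2 * z ^+ 2 + 2 * (a1 * x * (a2 * y)) + 2 * (a1 * x * (a2 * z))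
  + 2 * (a2 * y * (a2 * z)) by ring.
rewrite e1 e2; lra.
Qed.

(** [A] is to be [T (tau / N)], [Q] its growth factor [expR (lam * (tau / N))], and [E] is
    [expR lam]; [s1, r1] are the norms of [R1] and its inverse, [s2, r2] those for [R2]. *)
Context (A R1 R2 : H -> H) (n N : nat) (Q E s1 r1 s2 r2 M G : R).
Hypotheses (lA : linop A) (l1 : linop R1) (l2 : linop R2).
Hypotheses (n0 : (0 < n)%N) (nN : (n <= N)%N).
Hypotheses (Q1 : 1 <= Q) (QE : Q ^+ n <= E).
Hypotheses (s1p : 0 < s1) (r1p : 0 < r1) (s2p : 0 < s2) (r2p : 0 < r2).
Hypotheses (Mp : 0 < M) (G1 : 1 <= G).
Hypotheses (hs1 : forall x, hn (R1 x) <= s1 * hn x).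
Hypotheses (hr1 : forall x, hn x <= r1 * hn (R1 x)).
Hypotheses (hs2 : forall x, hn (R2 x) <= s2 * hn x).
Hypotheses (hr2 : forall x, hn x <= r2 * hn (R2 x)).
Hypothesis hA1 : forall x, hn (R1 (A x)) <= Q * hn (R1 x).
Hypothesis hA2 : forall x, hn (R2 (iter N A x)) <= hn (R2 x).
Hypothesis hM : forall p x, (p <= N)%N -> hn (iter p A x) <= M * hn x.
Hypothesis NG : N%:R <= G ^+ 2 * n%:R.

(** [kap] is [T1 + 2 * T2] from [sqr_sum3_le], with [T1 = s1 r1 E] and [T2 = s2 r2 M^2 G]. The
    weights [al] and [be] are balanced so that the upper and lower bounds on the cost share this
    constant. *)
Let kap := s1 * r1 * E + 2 * (s2 * r2 * M ^+ 2 * G).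
Let al := r1 * E / s1 / n%:R.
Let be := r2 / (s2 * G) / n%:R.

Let u (x : nat -> H) (p : nat) : H := x 0%N - iter p.+1 A (x p.+1).
Let f1 (x : nat -> H) (p : nat) : R := (Q^-1 ^+ p * hn (R1 (u x p))) ^+ 2.
Let f2 (x : nat -> H) (p : nat) : R := hn (R2 (iter (N.-1 - p) A (u x p))) ^+ 2.
Let f3 (w : H) (s : nat) : R := hn (R2 (iter s A w)) ^+ 2.
Let d (y : H) : R := hn (R2 y) ^+ 2 - hn (R2 (iter N A y)) ^+ 2.
Let F (x : nat -> H) : R := al * (\sum_(p < n) f1 x p) +
  be * (\sum_(p < n) f2 x p + \sum_(s < N) f3 (x 0%N) s).
Let tail K (x : nat -> H) : R := \sum_(j < K) d (x j.+1).

(* The finitely supported trajectory [.., x 2, x 1] reaches [x 0 = w] through the inputs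
   [x j - A (x j.+1)]. *)
Let cost (w : H) (r : R) : Prop := exists x K,
  [/\ x 0%N = w, forall j, (K <= j)%N -> x j.+1 = 0 & r = F x + be * tail K x].

Let E1 : 1 <= E. Proof. by apply: le_trans QE; rewrite exprn_ege1. Qed.
Let nR : 0 < n%:R :> R. Proof. by rewrite ltr0n. Qed.
Let al0 : 0 <= al.
Proof. by rewrite /al !mulr_ge0 ?invr_ge0 ?ltW //; apply: lt_le_trans E1. Qed.
Let be0 : 0 <= be.
Proof. by rewrite /be !mulr_ge0 ?invr_ge0 ?mulr_ge0 ?ltW //; apply: lt_le_trans G1. Qed.
Let d0 y : 0 <= d y.
Proof. by rewrite subr_ge0 ler_pXn2r ?nnegrE ?hn_ge0. Qed.

Let qhn := quadform_hnorm hip.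

Let linop_eval p : linop (fun x : nat -> H => x p). Proof. by []. Qed.

Let linop_comp {U V W : lmodType R[i]} (g : V -> W) (f : U -> V) :
  linop g -> linop f -> linop (fun x => g (f x)).
Proof. by move=> lg lf a x y; rewrite lf lg. Qed.

Let lu p : linop (fun x => u x p).
Proof.
by move=> a x y; rewrite /u (linop_iter _ p.+1 lA) opprD addrACA -scalerBr.
Qed.

Let hn20 : hn (R2 0) = 0. Proof. by rewrite (linop0 _ _ _ l2) (hn0 hip). Qed.

Let A0 p : iter p A 0 = 0. Proof. exact: linop0 (linop_iter _ p lA). Qed.

Let qf1 p : quadform (fun x => f1 x p).
Proof.
have -> : (fun x => f1 x p) = (fun x => (Q^-1 ^+ p) ^+ 2 * hn (R1 (u x p)) ^+ 2).
  by apply/funext => x; rewrite /f1 exprMn.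
apply: quadform_scale.
exact: (quadform_comp (fun z => hn z ^+ 2) _ (linop_comp _ _ l1 (lu p)) qhn).
Qed.

Let qf2 p : quadform (fun x => f2 x p).
Proof.
apply: (quadform_comp (fun z => hn z ^+ 2) (fun x => R2 (iter _ A (u x p))) _ qhn).
exact: linop_comp _ _ l2 (linop_comp _ _ (linop_iter _ _ lA) (lu p)).
Qed.

Let qN2 p : quadform (fun y => hn (R2 (iter p A y)) ^+ 2).
Proof.
apply: (quadform_comp (fun z => hn z ^+ 2) (fun x => R2 (iter _ A x)) _ qhn).
exact: linop_comp _ _ l2 (linop_iter _ _ lA).
Qed.

Let qF : quadform F.
Proof.
apply: quadform_add; apply: quadform_scale.
  by apply: quadform_sum => p; exact: qf1.
apply: quadform_add; apply: quadform_sum => p; first exact: qf2.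
exact: (quadform_comp _ _ (linop_eval 0) (qN2 p)).
Qed.

Let qtail K : quadform (tail K).
Proof.
apply: quadform_sum => j; apply: (quadform_comp d _ (linop_eval j.+1)).
have -> : d = (fun y => hn (R2 y) ^+ 2 + (-1) * hn (R2 (iter N A y)) ^+ 2).
  by apply/funext => y; rewrite mulN1r.
by apply: quadform_add; [exact: (qN2 0) | apply: quadform_scale].
Qed.

Let tail_le K K' x : (K <= K')%N -> tail K x <= tail K' x.
Proof.
move=> h; rewrite /tail -(subnKC h) big_split_ord /= lerDl.
by apply: sumr_ge0.
Qed.

Let tail_ext K K' x : (forall j, (K <= j)%N -> x j.+1 = 0) -> (K <= K')%N ->
  tail K' x = tail K x.
Proof.
move=> hx h; rewrite /tail -(subnKC h) big_split_ord /= [X in _ + X]big1 ?addr0 // => i _.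
by rewrite hx ?leq_addr // /d A0 subrr.
Qed.

Let F_ge0 x : 0 <= F x.
Proof.
rewrite /F addr_ge0 // mulr_ge0 // ?addr_ge0 // sumr_ge0 // => i _; exact: sqr_ge0.
Qed.

Let tail_ge0 K x : 0 <= tail K x. Proof. by apply: sumr_ge0. Qed.

Let cost_ge0 w r : cost w r -> 0 <= r.
Proof. by move=> [x [K [_ _ ->]]]; apply: addr_ge0 (F_ge0 x) (mulr_ge0 be0 (tail_ge0 K x)). Qed.

Let cost_shift w r : cost w r -> exists2 r', cost (A w) r' & r' <= r.
Proof.
move=> [x [K [x0 xK ->]]].
pose x' j := if j is j'.+1 then x j' else A (x 0%N).
exists (F x' + be * tail K.+1 x').
  exists x', K.+1; split => //=; first by rewrite x0.
  by case=> [|j] // h; exact: xK.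
(* The added input is zero, so passing to [x'] shifts [u] by one place and applies [A]. *)
have u0 : u x' 0 = 0 by rewrite /u /= subrr.
have uS p : u x' p.+1 = A (u x p).
  by rewrite /u (linopB _ _ _ lA).
(* The factor [Q^-1] gained by the shift absorbs the growth under [A]; the last term falls out. *)
have s1' : \sum_(p < n) f1 x' p <= \sum_(p < n) f1 x p.
  rewrite -(prednK n0) big_ord_recl big_ord_recr /= /f1 u0 (linop0 _ _ _ l1) (hn0 hip).
  rewrite mulr0 expr0n add0r; apply: ler_wpDr; first exact: sqr_ge0.
  apply: ler_sum => p _; rewrite uS ler_pXn2r ?nnegrE ?mulr_ge0 ?exprn_ge0 ?hn_ge0 ?invr_ge0 ?(le_trans ler01 Q1) //.
  have Q0 : 0 < Q by apply: lt_le_trans Q1.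
  rewrite /= /bump /= add1n.
  have qp : 0 <= Q^-1 ^+ p.+1 by rewrite exprn_ge0 // invr_ge0 ltW.
  apply: le_trans (ler_wpM2l qp (hA1 _)) _.
  by rewrite exprS mulrACA (mulrC _ Q) mulrA mulfV ?mul1r ?gt_eqF // mulrC.
(* The exponent [N - 1 - p] drops by one as [u] gains one [A], so the terms are only shifted. *)
have s2' : \sum_(p < n) f2 x' p <= \sum_(p < n) f2 x p.
  rewrite -(prednK n0) big_ord_recl big_ord_recr /= {1}/f2 u0 A0 hn20.
  rewrite expr0n add0r; apply: ler_wpDr; first exact: sqr_ge0.
  apply: ler_sum => p _; rewrite /f2 uS -iterSr /bump add1n.
  have pN : (p.+1 <= N.-1)%N.
    by apply: leq_trans (ltn_ord p) _; rewrite -!subn1 leq_sub2r.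
  by rewrite -subSn // subSS.
(* The dilation is isometric: the sum loses its term at [0] and gains one at [N], and the new tail
   term [d (x 0)] is exactly the difference. *)
have s3' : \sum_(s < N) f3 (x' 0%N) s + tail K.+1 x' = \sum_(s < N) f3 (x 0%N) s + tail K x.
  rewrite /tail big_ord_recl /= addrA; congr (_ + _).
  have -> : \sum_(s < N) f3 (A (x 0%N)) s = \sum_(s < N) f3 (x 0%N) s.+1.
    by apply: eq_bigr => i _; rewrite /f3 -iterSr.
  have e : \sum_(s < N.+1) f3 (x 0%N) s = f3 (x 0%N) 0 + \sum_(s < N) f3 (x 0%N) s.+1.
    by rewrite big_ord_recl.
  rewrite big_ord_recr /= in e.
  have -> : d (x 0%N) = f3 (x 0%N) 0 - f3 (x 0%N) N by [].
  lra.
have h1 := ler_wpM2l al0 s1'.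
rewrite /F -addrA -mulrDr -addrA s3' -addrA -mulrDr -!addrA; apply: lerD => //.
by apply: ler_wpM2l => //; rewrite lerD2r.
Qed.

(** Reach [w] from the zero state by a single input: then [u x p = w] for every [p] and the tail
    vanishes. *)
Let cost_upper w : exists2 r, cost w r & r <= kap * hn w ^+ 2.
Proof.
pose x (j : nat) : H := if j is 0 then w else 0.
exists (F x + be * tail 0 x); first by exists x, 0%N; split => // -[].
have hw : 0 <= hn w ^+ 2 by exact: sqr_ge0.
have ux p : u x p = w by rewrite /u [iter _ _ _](A0 p.+1) subr0.
have b1 p : f1 x p <= s1 ^+ 2 * hn w ^+ 2.
  rewrite /f1 ux -exprMn ler_pXn2r ?nnegrE ?mulr_ge0 ?hn_ge0 ?exprn_ge0 ?invr_ge0 ?(ltW s1p) ?(le_trans ler01 Q1) //.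
  apply: le_trans (hs1 w); rewrite ler_piMl ?hn_ge0 // exprn_ile1 ?invr_ge0 ?(le_trans ler01 Q1) //.
  by rewrite invf_le1 // (lt_le_trans ltr01 Q1).
have b2 p : (p <= N)%N -> hn (R2 (iter p A w)) ^+ 2 <= (s2 * M) ^+ 2 * hn w ^+ 2.
  move=> pN; rewrite -exprMn ler_pXn2r ?nnegrE ?hn_ge0 ?mulr_ge0 ?hn_ge0 ?(ltW s2p) ?(ltW Mp) //.
  by apply: le_trans (hs2 _) _; rewrite -mulrA ler_wpM2l ?(ltW s2p) ?hM.
have S1 : \sum_(p < n) f1 x p <= n%:R * (s1 ^+ 2 * hn w ^+ 2).
  apply: le_trans (_ : _ <= \sum_(p < n) s1 ^+ 2 * hn w ^+ 2) _.
    by apply: ler_sum => p _; exact: b1.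
  by rewrite sumr_const card_ord mulr_natl.
have S2 : \sum_(p < n) f2 x p <= n%:R * ((s2 * M) ^+ 2 * hn w ^+ 2).
  apply: le_trans (_ : _ <= \sum_(p < n) (s2 * M) ^+ 2 * hn w ^+ 2) _.
    by apply: ler_sum => p _; rewrite /f2 ux b2 // (leq_trans (leq_subr _ _)) ?leq_pred.
  by rewrite sumr_const card_ord mulr_natl.
have S3 : \sum_(s < N) f3 (x 0%N) s <= N%:R * ((s2 * M) ^+ 2 * hn w ^+ 2).
  apply: le_trans (_ : _ <= \sum_(s < N) (s2 * M) ^+ 2 * hn w ^+ 2) _.
    by apply: ler_sum => p _; rewrite /f3 b2 // ltnW.
  by rewrite sumr_const card_ord mulr_natl.
have G0 : 0 < G by apply: lt_le_trans G1.
rewrite [tail 0 x]big_ord0 mulr0 addr0 /F.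
have SM : 0 <= (s2 * M) ^+ 2 * hn w ^+ 2 by rewrite mulr_ge0 ?sqr_ge0.
have S23 : \sum_(p < n) f2 x p + \sum_(s < N) f3 (x 0%N) s <=
    (1 + G ^+ 2) * n%:R * ((s2 * M) ^+ 2 * hn w ^+ 2).
  apply: le_trans (lerD S2 S3) _; rewrite -mulrDl ler_wpM2r // mulrDl mul1r lerD2l //.
apply: le_trans (lerD (ler_wpM2l al0 S1) (ler_wpM2l be0 S23)) _.
have -> : al * (n%:R * (s1 ^+ 2 * hn w ^+ 2)) = s1 * r1 * E * hn w ^+ 2.
  by rewrite /al; field; rewrite !gt_eqF.
have -> : be * ((1 + G ^+ 2) * n%:R * ((s2 * M) ^+ 2 * hn w ^+ 2)) =
    (r2 * s2 * M ^+ 2 * hn w ^+ 2) * ((1 + G ^+ 2) / G).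
  by rewrite /be; field; rewrite !gt_eqF.
have hG : (1 + G ^+ 2) / G <= 2 * G.
  rewrite ler_pdivrMr //; have : 1 <= G ^+ 2 by rewrite exprn_ege1.
  by rewrite -mulrA -expr2; lra.
have c0 : 0 <= r2 * s2 * M ^+ 2 * hn w ^+ 2.
  by rewrite mulr_ge0 // mulr_ge0 ?sqr_ge0 // mulr_ge0 ?(ltW r2p) ?(ltW s2p).
have := ler_wpM2l c0 hG; rewrite /kap; lra.
Qed.

(** Each [p < n] bounds [w = u x p + A^(p+1) (x (p+1))] separately; averaging over [p] produces the
    sums in the cost, whose weights carry the factor [1 / n]. *)
Let cost_lower w r : cost w r -> hn w ^+ 2 <= kap * r.
Proof.
move=> [x [K0 [x0 xK ->]]].
have G0 : 0 < G by apply: lt_le_trans G1.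
have Q0 : 0 < Q by apply: lt_le_trans Q1.
pose K := maxn K0 n.
rewrite -(tail_ext _ K _ xK (leq_maxl _ _)).
have htail : \sum_(p < n) d (x p.+1) <= tail K x by exact: (tail_le n K x (leq_maxr _ _)).
(* The indices [N - 1 - p] are distinct because [n <= N]; reversing the full sum exhibits them as
   its initial part. *)
have hf3 : \sum_(p < n) f3 w (N.-1 - p) <= \sum_(s < N) f3 w s.
  rewrite [leRHS](reindex_inj rev_ord_inj) /=.
  rewrite -[in leRHS](subnKC nN) big_split_ord /= -[leLHS]addr0; apply: lerD.
    apply: ler_sum => p _; rewrite (_ : (_ - p.+1)%N = (N.-1 - p)%N) //.
    by rewrite subnKC // subnS predn_sub.
  by apply: sumr_ge0 => i _; exact: sqr_ge0.
pose T1 := s1 * r1 * E; pose T2 := s2 * r2 * M ^+ 2 * G.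
pose al' := r1 * E / s1; pose be' := r2 / (s2 * G).
have Ep : 0 < E by apply: lt_le_trans E1.
have T1p : 0 <= T1 by rewrite !mulr_ge0 // ltW.
have T2p : 0 <= T2 by rewrite /T2 mulr_ge0 ?(ltW G0) // mulr_ge0 ?sqr_ge0 // mulr_ge0 // ltW.
have al'p : 0 <= al' by rewrite divr_ge0 ?(ltW s1p) // mulr_ge0 // ltW.
have be'p : 0 <= be' by rewrite divr_ge0 ?(ltW r2p) // mulr_ge0 // ltW.
have step (p : 'I_n) : hn w ^+ 2 <=
    kap * (al' * f1 x p + be' * (f2 x p + (f3 w (N.-1 - p) + d (x p.+1)))).
  have pn := ltn_ord p.
  have Np : (N.-1 - p + p.+1)%N = N.
    by rewrite addnS subnK ?prednK ?(leq_trans n0 nN) // -ltnS prednK ?(leq_trans n0 nN) ?(leq_trans pn nN).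
  pose g := hn (R2 (iter (N.-1 - p) A (u x p))).
  pose S := Num.sqrt (f3 w (N.-1 - p) + d (x p.+1)).
  have S2 : S ^+ 2 = f3 w (N.-1 - p) + d (x p.+1) by rewrite sqr_sqrtr // addr_ge0 // sqr_ge0.
  (* Here [f = R2 A^(N-1-p) w] and [b = R2 A^N (x (p+1))], whose difference is
     [R2 A^(N-1-p) (u x p)]. *)
  have hgS : hn (R2 (x p.+1)) <= g + S.
    have := le_hnormB_sqrt (R2 (iter (N.-1 - p) A w)) _ _ (hA2 (x p.+1)).
    by rewrite /g /u x0 (linopB _ _ _ (linop_iter _ _ lA)) (linopB _ _ _ l2) -iterD Np.
  (* [Q^p <= Q^n <= E] undoes the discount [Q^-p]. *)
  have hu : hn (u x p) <= r1 * E * (Q^-1 ^+ p * hn (R1 (u x p))).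
    apply: le_trans (hr1 _) _; rewrite -mulrA ler_wpM2l ?(ltW r1p) // mulrA ler_peMl ?hn_ge0 //.
    rewrite exprVn ler_pdivlMr ?exprn_gt0 // mul1r; apply: le_trans QE.
    by rewrite ler_weXn2l // ltnW.
  have hx : hn (iter p.+1 A (x p.+1)) <= M * r2 * g + M * r2 * S.
    apply: le_trans (hM _ (x p.+1) (leq_trans pn nN)) _.
    rewrite -mulrDr -mulrA ler_wpM2l ?(ltW Mp) //; apply: le_trans (hr2 _) _.
    by rewrite ler_wpM2l ?(ltW r2p).
  have hw : hn w <= r1 * E * (Q^-1 ^+ p * hn (R1 (u x p))) + M * r2 * g + M * r2 * S.
    rewrite -x0 -(subrK (iter p.+1 A (x p.+1)) (x 0%N)).
    apply: le_trans (hnD hip _ _) _; rewrite -/(u x p); lra.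
  rewrite -S2; apply: le_trans (_ : _ <= (r1 * E * (Q^-1 ^+ p * hn (R1 (u x p))) + M * r2 * g + M * r2 * S) ^+ 2) _.
    by rewrite ler_pXn2r ?nnegrE ?hn_ge0 // (le_trans (hn_ge0 _) hw).
  apply: (sqr_sum3_le _ _ T1 T2) => //.
    by rewrite /T1 /al'; field; rewrite gt_eqF.
  by rewrite /T2 /be'; field; rewrite !gt_eqF.
have : \sum_(p < n) hn w ^+ 2 <= \sum_(p < n)
    kap * (al' * f1 x p + be' * (f2 x p + (f3 w (N.-1 - p) + d (x p.+1)))).
  by apply: ler_sum => p _; exact: step.
rewrite sumr_const card_ord -[_ *+ n]mulr_natl -big_distrr big_split -!big_distrr big_split big_split /=.
move=> h; rewrite -(ler_pM2l nR); apply: le_trans h _.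
have kp : 0 <= kap by rewrite addr_ge0 // mulr_ge0.
rewrite [leRHS]mulrCA; apply: ler_wpM2l => //.
have ea : al = al' / n%:R by [].
have eb : be = be' / n%:R by [].
have -> : n%:R * (F x + be * tail K x) = al' * (\sum_(p < n) f1 x p) +
    be' * (\sum_(p < n) f2 x p + (\sum_(s < N) f3 (x 0%N) s + tail K x)).
  by rewrite /F ea eb; field; rewrite gt_eqF.
rewrite lerD2l; apply: ler_wpM2l => //.
by rewrite lerD2l x0 lerD.
Qed.

Let quad_cost : quadform (fun w => inf (cost w : set R)).
Proof.
apply: quadform_inf.
- by move=> w; case: (cost_upper w) => r hr _; exists r.
- exact: cost_ge0.
- move=> w w' r r' [x [K [x0 xK ->]]] [x' [K' [x0' xK' ->]]].
  pose L := maxn K K'.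
  exists (F (x + x') + be * tail L (x + x')), (F (x - x') + be * tail L (x - x')).
  have hL j : (L <= j)%N -> x j.+1 = 0 /\ x' j.+1 = 0.
    by rewrite geq_max => /andP[/xK -> /xK' ->].
  split.
  + exists (x + x'), L; split => // [|j /hL [e e']]; first by rewrite -x0 -x0'.
    by rewrite !fctE e e' addr0.
  + exists (x - x'), L; split => // [|j /hL [e e']]; first by rewrite -x0 -x0'.
    by rewrite !fctE e e' subr0.
  + rewrite -(tail_ext _ L _ xK (leq_maxl _ _)) -(tail_ext _ L _ xK' (leq_maxr _ _)).
    by rewrite addrACA qF.1 -mulrDr (qtail L).1; ring.
- move=> c w r [x [K [x0 xK ->]]]; exists (c *: x), K; split.
  + by rewrite -x0.
  + by move=> j /xK e; rewrite fctE e scaler0.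
  + by rewrite qF.2 (qtail K).2; ring.
Qed.

Lemma discrete_renorm : exists q : H -> R, [/\ quadform q,
  forall w, hn w ^+ 2 <= kap * q w, forall w, q w <= kap * hn w ^+ 2 &
  forall w, q (A w) <= q w].
Proof.
have hlb w : has_lbound (cost w : set R) by exists 0 => r /cost_ge0.
have ne w : (cost w : set R) !=set0 by case: (cost_upper w) => r hr _; exists r.
have Ep : 0 < E by apply: lt_le_trans E1.
have G0 : 0 < G by apply: lt_le_trans G1.
have kp : 0 < kap.
  by rewrite addr_gt0 ?mulr_gt0 // exprn_gt0.
exists (fun w => inf (cost w : set R)); split => //.
- move=> w; rewrite -ler_pdivrMl //; apply: lb_le_inf => // r /cost_lower h.
  by rewrite ler_pdivrMl.
- by move=> w; have [r hr] := cost_upper w; apply: le_trans; exact: ge_inf.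
- move=> w; apply: lb_le_inf => // r /cost_shift[r' hr']; apply: le_trans.
  exact: ge_inf.
Qed.

End Discrete.

(** * Passage to the limit *)

(** The image of an ultrafilter is an ultrafilter, so it converges once it contains a compact
    interval. One filter serves all bounded sequences, which keeps limits at different vectors
    compatible. *)
Lemma ultrafilter_bounded_cvg (R : realType) : exists F : set_system nat,
  [/\ ProperFilter F, \oo `<=` F &
  forall u : nat -> R, (exists C : R, forall n, `|u n| <= C) -> cvg (u @ F)].
Proof.
have [F [UF hF]] := ultraFilterLemma (F := \oo) _.
exists F; split => //; first exact: ultra_proper.
move=> u [C hC].
have PF : ProperFilter F by exact: ultra_proper.
have UF' : UltraFilter (u @ F).
  split; first exact: fmap_proper_filter.
  move=> G PG hG; apply/seteqP; split => // A GA.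
  have [//|FA] := pselect ((u @ F) A); exfalso.
  have [h|h] := @in_ultra_setVsetC _ F (u @^-1` A) UF; first exact: FA.
  have GcA : G (~` A) by apply: hG.
  have h0 := filterI GA GcA; rewrite setICr in h0; exact: (filter_not_empty G (h0 _)).
have := @segment_compact R (- C) C; rewrite compact_ultra => /(_ (u @ F) UF').
case.
  by apply: (@filterE _ F) => n /=; rewrite in_itv /= -ler_norml.
by move=> l [_ hl]; apply/cvg_ex; exists l.
Qed.

(** The affine inequality is general enough to transfer both norm bounds and monotonicity along the
    semigroup. *)
Lemma quadform_limit (R : realType) (V : lmodType R[i]) (q : nat -> V -> R) :
  (forall k, quadform (q k)) -> (forall x, exists C : R, forall k, `|q k x| <= C) ->
  exists q' : V -> R, quadform q' /\ forall (a b c : R) (x y : V),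
    (exists K, forall k, (K <= k)%N -> a * q k x <= b * q k y + c) ->
    a * q' x <= b * q' y + c.
Proof.
move=> hq bq; have [F [PF hF hcv]] := ultrafilter_bounded_cvg R.
have qc x : q ^~ x @ F --> lim (q ^~ x @ F) by exact: (hcv _ (bq x)).
exists (fun x => lim (q ^~ x @ F)); split; last first.
  move=> a b c x y [K hK].
  apply: (@ler_cvg_to _ F PF R (fun k => a * q k x) (fun k => b * q k y + c)).
  - exact: cvgMr.
  - by apply: cvgD; [exact: cvgMr | exact: cvg_cst].
  - by apply: hF; exists K.
have uniq (f : nat -> R) (l l' : R) : f @ F --> l -> f @ F --> l' -> l = l'.
  by move=> h1 h2; rewrite -(cvg_lim _ h1) // -(cvg_lim _ h2).
split => [x y|c x].
- apply: (uniq (fun k => q k (x + y) + q k (x - y))).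
  + exact: cvgD.
  + have -> : (fun k => q k (x + y) + q k (x - y)) = (fun k => 2 * (q k x + q k y)).
      by apply/funext => k; rewrite (hq k).1.
    by apply: cvgMr; apply: cvgD.
- apply: (uniq (fun k => q k (c *: x))).
  + exact: qc.
  + have -> : (fun k => q k (c *: x)) =
        (fun k => (complex.Re c ^+ 2 + complex.Im c ^+ 2) * q k x).
      by apply/funext => k; rewrite (hq k).2.
    exact: cvgMr.
Qed.

(** * Renorming the semigroup *)

Section Semigroup.
Context {R : realType} {H : lmodType R[i]} {ip : H -> H -> R[i]}.
Hypothesis hH : is_hilbert ip.
Let hip : is_inner_product ip := hH.1.

Local Notation hn := (hnorm ip).

Lemma bounded_op_comp (f g : H -> H) : bounded_op ip f -> bounded_op ip g ->
  bounded_op ip (fun x => f (g x)).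
Proof.
move=> hf hg; split; first by move=> a x y; rewrite hg.1 hf.1.
exists (opnorm ip f * opnorm ip g) => x; apply: le_trans (le_opnorm hH _ _ hf) _.
by rewrite -mulrA ler_wpM2l ?opnorm_ge0 // le_opnorm.
Qed.

Lemma bounded_op_scale (c : R) (f : H -> H) : bounded_op ip f ->
  bounded_op ip (fun x => c%:C%C *: f x).
Proof.
move=> hf; split; first by move=> a x y; rewrite hf.1 scalerDr !scalerA mulrC.
exists (`|c| * opnorm ip f) => x; rewrite (hnZ hip) -mulrA ler_wpM2l //.
exact: le_opnorm.
Qed.

Lemma opnorm_similar_le1 (Rop Rinv f : H -> H) : invertible_pair ip Rop Rinv ->
  bounded_op ip f -> opnorm ip (fun x => Rop (f (Rinv x))) <= 1 ->
  forall x, hn (Rop (f x)) <= hn (Rop x).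
Proof.
move=> [b1 [b2 [_ e2]]] bf h x.
have := le_opnorm hH _ (Rop x) (bounded_op_comp _ _ b1 (bounded_op_comp _ _ bf b2)).
rewrite e2 => /le_trans; apply; rewrite ler_piMl ?hn_ge0 //.
Qed.

Lemma opnorm_gt0 (f g : H -> H) (x0 : H) : x0 <> 0 -> bounded_op ip f ->
  (forall x, g (f x) = x) -> g 0 = 0 -> 0 < opnorm ip f.
Proof.
move=> x00 bf gf g0; rewrite lt_def opnorm_ge0 // andbT; apply/eqP => e.
have := le_opnorm hH f x0 bf; rewrite e mul0r => h.
have : f x0 = 0 by apply: (hn0_eq0 hip); apply/eqP; rewrite eq_le h hn_ge0.
by move=> f0; apply: x00; rewrite -(gf x0) f0.
Qed.

Context (T : R -> H -> H) (lam tau : R).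
Hypotheses (hT : C0_semigroup ip T) (lam0 : 0 < lam) (tau0 : 0 < tau).
Context (R1 R1i R2 R2i : H -> H) (x0 : H).
Hypotheses (hR1 : invertible_pair ip R1 R1i) (hR2 : invertible_pair ip R2 R2i).
Hypothesis hc1 : forall t, 0 <= t ->
  opnorm ip (fun x => R1 (rescale lam T t (R1i x))) <= 1.
Hypothesis hc2 : opnorm ip (fun x => R2 (T tau (R2i x))) <= 1.
Hypothesis x00 : x0 <> 0.

Let M := sup_norm_on ip T tau.
Let G := Num.sqrt 2 * Num.max 1 (Num.sqrt tau).
(** The factor [expR lam] is replaced by the mean in the final bound only through [expR_le_mean]. *)
Let kap := opnorm ip R1 * opnorm ip R1i * expR lam +
  2 * (opnorm ip R2 * opnorm ip R2i * M ^+ 2 * G).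

Let bT t : 0 <= t -> bounded_op ip (T t). Proof. exact: hT.1. Qed.

Let growth t y : 0 <= t -> hn (R1 (T t y)) <= expR (lam * t) * hn (R1 y).
Proof.
move=> t0; have := opnorm_similar_le1 _ _ _ hR1 (bounded_op_scale _ _ (bT _ t0)) (hc1 _ t0) y.
rewrite /rescale (linopZ _ _ R1 hR1.1.1) (hnZ hip) ger0_norm ?expR_ge0 //.
by rewrite mulNr expRN ler_pdivrMl ?expR_gt0.
Qed.

Let inv1 x : hn x <= opnorm ip R1i * hn (R1 x).
Proof. by case: hR1 => _ [b [_ e]]; rewrite -{1}(e x) le_opnorm. Qed.

Let inv2 x : hn x <= opnorm ip R2i * hn (R2 x).
Proof. by case: hR2 => _ [b [_ e]]; rewrite -{1}(e x) le_opnorm. Qed.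

Let opnorm_T_le t : 0 <= t <= tau -> opnorm ip (T t) <= M.
Proof.
move=> ht; apply: ub_le_sup; last by exists t.
(* The real [sup] defining [M] needs an upper bound; the growth estimate provides one. *)
exists (opnorm ip R1i * (expR (lam * tau) * opnorm ip R1)) => _ [s /= /andP[s0 s1] <-].
have r10 : 0 <= opnorm ip R1i by apply: opnorm_ge0 => //; case: hR1 => _ [].
have r20 : 0 <= opnorm ip R1 by apply: opnorm_ge0 => //; case: hR1.
apply: opnorm_le => //; first by rewrite !mulr_ge0 ?expR_ge0.
move=> x; apply: le_trans (inv1 _) _; rewrite -mulrA ler_wpM2l //.
apply: le_trans (growth _ _ s0) _; rewrite -mulrA ler_pM ?expR_ge0 ?hn_ge0 //.
  by rewrite ler_expR ler_wpM2l // ltW.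
by apply: le_opnorm => //; case: hR1.
Qed.

Let hMT t x : 0 <= t <= tau -> hn (T t x) <= M * hn x.
Proof.
move=> ht; case/andP: (ht) => t0 _; apply: le_trans (le_opnorm hH _ _ (bT _ t0)) _.
by rewrite ler_wpM2r ?hn_ge0 // opnorm_T_le.
Qed.

Let hn_x0 : 0 < hn x0.
Proof.
by rewrite lt_def hn_ge0 andbT; apply/eqP => h; apply: x00; exact: (hn0_eq0 hip).
Qed.

Let M1 : 1 <= M.
Proof.
have := hMT 0 x0; rewrite lexx ltW // => /(_ isT); rewrite hT.2.1.
by rewrite -{1}[hn x0]mul1r ler_pM2r.
Qed.

Let G1 : 1 <= G.
Proof.
have s1 : 1 <= Num.sqrt 2 :> R by rewrite -[leLHS]sqrtr1 ler_wsqrtr // ler1n.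
by rewrite /G -[leLHS]mulr1 ler_pM // le_max lexx.
Qed.

Let G2 : G ^+ 2 = 2 * Num.max 1 tau.
Proof.
rewrite /G exprMn sqr_sqrtr //; congr (_ * _).
have [h|h] := leP tau 1.
  by rewrite !(max_idPl _) ?expr1n // -[leRHS]sqrtr1 ler_wsqrtr.
rewrite !(max_idPr _) ?(ltW h) ?sqr_sqrtr ?(ltW tau0) //.
by rewrite -[leLHS]sqrtr1 ler_wsqrtr // ltW.
Qed.

Let iter_T (dl : R) p x : 0 <= dl -> iter p (T dl) x = T (p%:R * dl) x.
Proof.
move=> d0; elim: p => [|p ih]; first by rewrite mul0r hT.2.1.
by rewrite /= ih -hT.2.2.1 ?mulr_ge0 // -natr1 mulrDl mul1r addrC.
Qed.

(* The factor [sqrt 2] in [G] absorbs the rounding of [N / tau] to an integer. *)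
Let subdivision (N : nat) : (0 < N)%N -> tau <= N%:R ->
  exists n : nat, [/\ (0 < n)%N, (n <= N)%N, n%:R * tau <= N%:R & N%:R <= G ^+ 2 * n%:R].
Proof.
(* Take [n = N] if [tau <= 1], otherwise the integer part of [N / tau]; either way [n] steps of
   length [tau / N] last at most time 1. *)
move=> N0 tN; have [h|h] := leP tau 1.
  exists N; split => //; first by rewrite ler_piMr.
  by rewrite ler_peMl // exprn_ege1.
have Nt0 : 0 <= N%:R / tau by rewrite divr_ge0 // ltW.
have /andP[m1 m2] := truncn_itv Nt0.
have n0 : (0 < Num.truncn (N%:R / tau))%N by rewrite truncn_gt0 ler_pdivlMr // mul1r.
exists (Num.truncn (N%:R / tau)); split => //.
- rewrite -(ler_nat R); apply: le_trans m1 _.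
  by rewrite ler_pdivrMr // ler_peMr // ltW.
- by rewrite -ler_pdivlMr.
- rewrite G2 (max_idPr _) ?(ltW h) //; move: m2 n0; rewrite ltr_pdivrMr // -natr1.
  set n := Num.truncn _ => m2; rewrite -(ler_nat R) => n1; apply: le_trans (ltW m2) _.
  have := ler_wpM2r (ltW tau0) n1; lra.
Qed.

Let discrete (N : nat) : (0 < N)%N -> tau <= N%:R -> exists q : H -> R,
  [/\ quadform q, forall w, hn w ^+ 2 <= kap * q w, forall w, q w <= kap * hn w ^+ 2 &
  forall w p, q (T (p%:R * (tau / N%:R)) w) <= q w].
Proof.
move=> N0 tN; have [n [n0 nN ntN NG]] := subdivision N N0 tN.
have NR : 0 < N%:R :> R by rewrite ltr0n.
pose dl := tau / N%:R; have d0 : 0 <= dl by rewrite divr_ge0 ?ltW.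
have dN : N%:R * dl = tau by rewrite /dl mulrCA mulfV ?mulr1 // gt_eqF.
case: (hR1) => b1 [b1i [e11 e12]]; case: (hR2) => b2 [b2i [e21 e22]].
have [|||||||||||||||||||||q [q1 q2 q3 q4]] := discrete_renorm hip (T dl) R1 R2 n N
  (expR (lam * dl)) (expR lam) (opnorm ip R1) (opnorm ip R1i) (opnorm ip R2) (opnorm ip R2i) M G.
all: try by [].
- exact: (bT _ d0).1.
- exact: b1.1.
- exact: b2.1.
- by rewrite -expR0 ler_expR mulr_ge0 // ltW.
- rewrite -expRM_natl ler_expR mulrCA ler_piMr ?(ltW lam0) //.
  by rewrite /dl mulrA ler_pdivrMr // mul1r.
- exact: (opnorm_gt0 R1 R1i x0 x00 b1 e12 (linop0 _ _ _ b1i.1)).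
- exact: (opnorm_gt0 R1i R1 x0 x00 b1i e11 (linop0 _ _ _ b1.1)).
- exact: (opnorm_gt0 R2 R2i x0 x00 b2 e22 (linop0 _ _ _ b2i.1)).
- exact: (opnorm_gt0 R2i R2 x0 x00 b2i e21 (linop0 _ _ _ b2.1)).
- by apply: lt_le_trans M1.
- by move=> x; apply: le_opnorm.
- by move=> x; apply: le_opnorm.
- by move=> x; apply: growth.
- move=> x; rewrite iter_T // dN.
  by apply: (opnorm_similar_le1 _ _ _ hR2 (bT _ (ltW tau0)) hc2).
- move=> p x pN; rewrite iter_T //; apply: hMT; rewrite mulr_ge0 //= -dN.
  by rewrite ler_wpM2r // ler_nat.
exists q; split => // w p; rewrite -/dl -iter_T //.
by elim: p => [|p ih] //=; apply: le_trans (q4 _) ih.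
Qed.

(** The first factor ensures [tau <= dyadic k]; the powers of 2 nest the time grids. *)
Let dyadic (k : nat) : nat := ((Num.truncn tau).+1 * 2 ^ k)%N.

Lemma semigroup_renorm : exists Rop Rinv, [/\ invertible_pair ip Rop Rinv,
  forall t, 0 <= t -> opnorm ip (fun x => Rop (T t (Rinv x))) <= 1 &
  opnorm ip Rop * opnorm ip Rinv <= kap].
Proof.
have dy0 k : (0 < dyadic k)%N by rewrite muln_gt0 expn_gt0.
have dyt k : tau <= (dyadic k)%:R.
  apply: le_trans (ltW (truncnS_gt tau)) _; rewrite ler_nat.
  by rewrite leq_pmulr // expn_gt0.
have [|q hq] := @boolp.choice nat (H -> R) (fun k q =>
    [/\ quadform q, forall w, hn w ^+ 2 <= kap * q w, forall w, q w <= kap * hn w ^+ 2 &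
      forall w p, q (T (p%:R * (tau / (dyadic k)%:R)) w) <= q w]).
  by move=> k; exact: discrete.
have kap_ge0 : 0 <= kap.
  rewrite /kap; case: hR1 => b1 [b1i _]; case: hR2 => b2 [b2i _].
  rewrite addr_ge0 //; first by rewrite !mulr_ge0 ?opnorm_ge0 ?expR_ge0.
  rewrite mulr_ge0 // mulr_ge0 ?(le_trans ler01 G1) // mulr_ge0 ?sqr_ge0 //.
  by rewrite mulr_ge0 ?opnorm_ge0.
have kap_gt0 : 0 < kap.
  rewrite lt_def kap_ge0 andbT; apply/eqP => e; case: (hq 0) => _ /(_ x0) h _ _.
  by move: h; rewrite e mul0r leNgt exprn_gt0.
have q_ge0 k x : 0 <= q k x.
  by case: (hq k) => _ /(_ x) h _ _; rewrite -(pmulr_rge0 _ kap_gt0) (le_trans _ h) ?sqr_ge0.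
have [|x|q' [qq' hq']] := @quadform_limit R H q; first by move=> k; case: (hq k).
  exists (kap * hn x ^+ 2) => k; rewrite ger0_norm //.
  by case: (hq k) => _ _ /(_ x).
have q1 w : hn w ^+ 2 <= kap * q' w.
  have := hq' 0 kap (- hn w ^+ 2) w w; rewrite mul0r subr_ge0; apply.
  exists 0%N => k _; rewrite mul0r subr_ge0.
  by case: (hq k) => _ /(_ w).
have q2 w : q' w <= kap * hn w ^+ 2.
  have := hq' 1 0 (kap * hn w ^+ 2) w w; rewrite mul0r mul1r add0r; apply.
  exists 0%N => k _; rewrite mul0r mul1r add0r.
  by case: (hq k) => _ _ /(_ w).
(* A grid time of level [k] is a grid time of every later level, so the inequality holds eventually
   along the sequence. *)
have q3 w k p : q' (T (p%:R * (tau / (dyadic k)%:R)) w) <= q' w.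
  have := hq' 1 1 0 (T (p%:R * (tau / (dyadic k)%:R)) w) w.
  rewrite !mul1r addr0; apply; exists k => j kj; rewrite !mul1r addr0.
  have -> : p%:R * (tau / (dyadic k)%:R) =
      (p * 2 ^ (j - k))%N%:R * (tau / (dyadic j)%:R) :> R.
    rewrite /dyadic -{2}(subnKC kj) expnD !natrM.
    by field; rewrite !pnatr_eq0 -!lt0n !expn_gt0 nat1r pnatr_eq0.
  by case: (hq j) => _ _ _ /(_ w).
have kap1 : 1 <= kap.
  have h := le_trans (q1 x0) (ler_wpM2l kap_ge0 (q2 x0)).
  rewrite -(ler_pXn2r (n := 2)) ?nnegrE // expr1n.
  by rewrite -(ler_pM2r (exprn_gt0 2 hn_x0)) mul1r (le_trans h) // mulrA expr2.
have [Rop [Rinv [hR eR]]] := quadform_renorm hH q' kap kap1 qq' q1 q2.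
exists Rop, Rinv; split => //; case: (hR) => b1 [b2 [e1 e2]].
- have le_hn x y : q' x <= q' y -> hn (Rop x) <= hn (Rop y).
    by rewrite -!eR ler_pXn2r ?nnegrE ?hn_ge0.
  move=> t t0; apply: opnorm_le => // x; rewrite mul1r -{2}(e1 x); move: (Rinv x) => {x} x.
  apply/ler_addgt0Pr => e e0.
  pose C := opnorm ip Rop * opnorm ip (T t).
  have C0 : 0 <= C by rewrite mulr_ge0 ?opnorm_ge0 //; exact: bT.
  have C1 : 0 < C + 1 by rewrite ltr_wpDl.
  have [d [d0 hd]] := hT.2.2.2 x (e / (C + 1)) (divr_gt0 e0 C1).
  (* Since [tau / d < k + 1 <= 2^k], the mesh [dl] of this level is below [d]. *)
  pose k := Num.truncn (tau / d).
  pose dl := tau / (dyadic k)%:R.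
  have dl0 : 0 < dl by rewrite divr_gt0 // ltr0n.
  have dld : dl < d.
    rewrite /dl ltr_pdivrMr ?ltr0n // mulrC -ltr_pdivrMr //.
    apply: lt_le_trans (truncnS_gt _) _; rewrite ler_nat.
    apply: leq_trans (ltn_expl _ (ltnSn 1)) _.
    by rewrite leq_pmull.
  have tdl : 0 <= t / dl by rewrite divr_ge0 // ltW.
  have /andP[p1 p2] := truncn_itv tdl.
  (* Rounding [t] up to a grid time [t + s] keeps [s >= 0], so the error is [T t (x - T s x)], small
     by strong continuity at 0. *)
  pose p := (Num.truncn (t / dl)).+1.
  pose s := p%:R * dl - t.
  have s0 : 0 <= s by rewrite subr_ge0 -ler_pdivrMr // ltW.
  have sd : s < d.
    apply: le_lt_trans dld; rewrite lerBlDr /p -natr1 mulrDl mul1r addrC lerD2l.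
    by rewrite -ler_pdivlMr.
  have eT : T (p%:R * dl) x = T t (T s x).
    by rewrite -hT.2.2.1 // addrC subrK.
  rewrite -(subrK (T t (T s x)) (T t x)) (linopD _ _ Rop b1.1).
  apply: le_trans (hnD hip _ _) _; rewrite addrC; apply: lerD.
    by rewrite -eT; apply: le_hn; exact: q3.
  rewrite -(linopB _ _ (T t) (bT _ t0).1).
  apply: le_trans (le_opnorm hH _ _ b1) _.
  apply: le_trans (ler_wpM2l (opnorm_ge0 hH _ b1) (le_opnorm hH _ _ (bT _ t0))) _.
  rewrite mulrA -/C (hnBC hip); apply: le_trans (ler_wpM2l C0 (ltW (hd _ s0 sd))) _.
  by rewrite mulrA ler_pdivrMr // mulrC ler_pM2l // lerDl.
- have sk : 0 <= Num.sqrt kap by exact: sqrtr_ge0.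
  rewrite -[leRHS]sqr_sqrtr // expr2; apply: ler_pM; rewrite ?opnorm_ge0 //.
  + apply: opnorm_le => // x.
    rewrite -(ler_pXn2r (n := 2)) ?nnegrE ?mulr_ge0 ?hn_ge0 //.
    by rewrite eR exprMn sqr_sqrtr.
  + apply: opnorm_le => // x.
    rewrite -(ler_pXn2r (n := 2)) ?nnegrE ?mulr_ge0 ?hn_ge0 //.
    by have := q1 (Rinv x); rewrite -eR e1 exprMn (sqr_sqrtr kap_ge0).
Qed.

End Semigroup.

(** * The theorem *)

(** With [E = expR l] the claim is [sqrt 2 * l * E <= E^2 - 1]. It holds with [E] replaced by its
    lower bound [s = (1 + l / 2)^2], by a polynomial identity and [sqrt 2 <= 3 / 2]; passing from
    [s] to [E] adds [(E - s) (E + s - sqrt 2 * l) >= 0] to the gap. *)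
Lemma expR_le_mean (R : realType) (l : R) : 0 < l ->
  expR l <= Num.sqrt 2 * ((expR (2 * l) - 1) / (2 * l)).
Proof.
move=> l0; set E := expR l; set s := (1 + l / 2) ^+ 2.
have Es : s <= E.
  rewrite /E /s; have -> : expR l = expR (l / 2) ^+ 2.
    by rewrite -expRM_natl; congr expR; field.
  by rewrite ler_pXn2r ?nnegrE ?expR_ge0 ?expR_ge1Dx // addr_ge0 // divr_ge0 // ltW.
have -> : expR (2 * l) = E ^+ 2 by rewrite expRM_natl.
have r0 : 0 <= Num.sqrt 2 :> R by exact: sqrtr_ge0.
have r2 : Num.sqrt 2 * Num.sqrt 2 = 2 :> R by rewrite -expr2 sqr_sqrtr.
have r1 : Num.sqrt 2 <= 3 / 2 :> R.
  rewrite -(ler_pXn2r (n := 2)) ?nnegrE ?divr_ge0 // sqr_sqrtr //.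
  have -> : (3 / 2) ^+ 2 = 9 / 4 :> R by field.
  lra.
have s1 : 1 <= s by rewrite exprn_ege1 // lerDl divr_ge0 // ltW.
suff h : Num.sqrt 2 * l * E <= E ^+ 2 - 1.
  rewrite mulrA ler_pdivlMr ?mulr_gt0 //.
  apply: le_trans (ler_wpM2l r0 h).
  by rewrite !mulrA r2; lra.
have hs : Num.sqrt 2 * l * s <= s ^+ 2 - 1.
  have h1 : Num.sqrt 2 * l * s <= 3 / 2 * l * s.
    by rewrite ler_wpM2r ?ler_wpM2r ?(ltW l0) // (le_trans ler01 s1).
  apply: le_trans h1 _; rewrite /s -subr_ge0.
  have -> : ((1 + l / 2) ^+ 2) ^+ 2 - 1 - 3 / 2 * l * (1 + l / 2) ^+ 2 =
    l / 2 + l ^+ 3 / 8 + l ^+ 4 / 16 by field.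
  by rewrite !addr_ge0 ?divr_ge0 ?exprn_ge0 ?(ltW l0).
have h2 : 0 <= (E - s) * (E + s - Num.sqrt 2 * l).
  apply: mulr_ge0; first by rewrite subr_ge0.
  have : Num.sqrt 2 * l <= s ^+ 2 / s - 1 / s.
    rewrite -mulrBl ler_pdivlMr //; exact: lt_le_trans s1.
  have -> : s ^+ 2 / s = s by field; rewrite gt_eqF // (lt_le_trans ltr01 s1).
  have : 0 <= 1 / s by rewrite divr_ge0 // (le_trans ler01 s1).
  lra.
nra.
Qed.

Lemma semigroup_similar (R : realType) (H : lmodType R[i]) (ip : H -> H -> R[i])
    (T : R -> H -> H) (lam tau : R) (R1 R1i R2 R2i : H -> H) :
  is_hilbert ip -> C0_semigroup ip T -> 0 < lam -> 0 < tau ->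
  invertible_pair ip R1 R1i -> invertible_pair ip R2 R2i ->
  (forall t, 0 <= t -> opnorm ip (fun x => R1 (rescale lam T t (R1i x))) <= 1) ->
  opnorm ip (fun x => R2 (T tau (R2i x))) <= 1 ->
  exists Rop Rinv, [/\ invertible_pair ip Rop Rinv,
    forall t, 0 <= t -> opnorm ip (fun x => Rop (T t (Rinv x))) <= 1 &
    opnorm ip Rop * opnorm ip Rinv <=
      Num.sqrt 2 * (opnorm ip R1 * opnorm ip R1i) * ((expR (2 * lam) - 1) / (2 * lam)) +
      2 * Num.sqrt 2 * (opnorm ip R2 * opnorm ip R2i) *
        (sup_norm_on ip T tau ^+ 2 * Num.max 1 (Num.sqrt tau))].
Proof.
move=> hH hT lam0 tau0 hR1 hR2 hc1 hc2; have hip := hH.1.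
have p1 : 0 <= opnorm ip R1 * opnorm ip R1i.
  by case: hR1 => b1 [b2 _]; rewrite mulr_ge0 ?(opnorm_ge0 hH).
have p2 : 0 <= opnorm ip R2 * opnorm ip R2i.
  by case: hR2 => b1 [b2 _]; rewrite mulr_ge0 ?(opnorm_ge0 hH).
have hE := expR_le_mean R lam lam0.
have [[x0 x00]|triv] := pselect (exists x0 : H, x0 <> 0).
  have [Rop [Rinv [h1 h2 h3]]] :=
    semigroup_renorm hH T lam tau hT lam0 tau0 R1 R1i R2 R2i x0 hR1 hR2 hc1 hc2 x00.
  exists Rop, Rinv; split => //; apply: le_trans h3 _; apply: lerD.
    by apply: le_trans (ler_wpM2l p1 hE) _; rewrite mulrCA mulrA.
  by rewrite le_eqVlt; apply/orP; left; apply/eqP; ring.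
(* On the zero space all operator norms vanish, so [R1] itself serves. *)
have x0 (x : H) : x = 0 by apply: contrapT => h; apply: triv; exists x.
have op0 (f : H -> H) : opnorm ip f <= 0.
  by apply: (opnorm_le hH) => // x; rewrite mul0r (x0 (f x)) (hn0 hip).
exists R1, R1i; split => //.
  by move=> t _; apply: le_trans (op0 _) ler01.
apply: le_trans (_ : 0 <= _).
  by case: hR1 => b1 [b2 _]; rewrite mulr_le0_ge0 ?(opnorm_ge0 hH).
rewrite addr_ge0 //.
  rewrite -mulrA mulrCA mulr_ge0 //; exact: le_trans (expR_ge0 _) hE.
rewrite mulr_ge0 //; first by rewrite mulr_ge0 // mulr_ge0 ?sqrtr_ge0.
by rewrite mulr_ge0 ?sqr_ge0 // le_max ler01.
Qed.

Local Open Scope ereal_scope.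

Theorem theorem5p1 (R : realType) (H : lmodType R[i]) (ip : H -> H -> R[i])
    (T : R -> H -> H) (lam tau : R) :
  is_hilbert ip -> C0_semigroup ip T -> (0 < lam)%R -> (0 < tau)%R ->
  sg_similar_to_contractions ip (rescale lam T) ->
  similar_to_contraction ip (T tau) ->
  sg_similar_to_contractions ip T /\
  sg_sim_const ip T <=
    (Num.sqrt 2)%:E * sg_sim_const ip (rescale lam T)
      * ((expR (2 * lam) - 1) / (2 * lam))%:E
    + (2 * Num.sqrt 2)%:E * sim_const ip (T tau)
      * ((sup_norm_on ip T tau) ^+ 2 * Num.max 1 (Num.sqrt tau))%:E.
Proof.
move=> hH hT lam0 tau0 [R1 [R1i [hR1 hc1]]] [R2 [R2i [hR2 hc2]]].
split.
  have [Rop [Rinv [h1 h2 _]]] :=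
    semigroup_similar _ _ _ _ _ _ _ _ _ _ hH hT lam0 tau0 hR1 hR2 hc1 hc2.
  by exists Rop, Rinv.
(* Both infima are over nonempty sets of nonnegative reals, hence finite, so the estimate reduces to
   real arithmetic. *)
have inf_fin (S : set \bar R) (r : R) : S r%:E -> (forall s, S s -> 0 <= s) ->
    ereal_inf S \is a fin_num.
  move=> Sr S0; rewrite ge0_fin_numE; last by apply/ereal_infP.
  by apply: le_lt_trans (ltry r); exact: ereal_inf_lbound.
have pair_ge0 (A B : H -> H) : invertible_pair ip A B ->
    0 <= (opnorm ip A * opnorm ip B)%:E.
  by case=> b1 [b2 _]; rewrite lee_fin mulr_ge0 ?(opnorm_ge0 hH).
have fin1 : sg_sim_const ip (rescale lam T) \is a fin_num.
  apply: (inf_fin _ (opnorm ip R1 * opnorm ip R1i)%R); first by exists R1, R1i.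
  by move=> _ [A [B [hAB [_ ->]]]]; exact: pair_ge0.
have fin2 : sim_const ip (T tau) \is a fin_num.
  apply: (inf_fin _ (opnorm ip R2 * opnorm ip R2i)%R); first by exists R2, R2i.
  by move=> _ [A [B [hAB [_ ->]]]]; exact: pair_ge0.
set K1 := ((expR _ - 1) / _)%R; set K2 := (_ * Num.max _ _)%R.
have K10 : (0 <= K1)%R.
  by rewrite divr_ge0 ?mulr_ge0 ?(ltW lam0) // subr_ge0 -expR0 ler_expR mulr_ge0 // ltW.
have K20 : (0 <= K2)%R by rewrite mulr_ge0 ?sqr_ge0 // le_max ler01.
have r0 : (0 <= Num.sqrt 2 :> R)%R by exact: sqrtr_ge0.
(* Both similarities are taken optimal up to [e / (a + b + 1)], where [a] and [b] are the
   coefficients of the two constants; the [1] keeps the denominator positive. *)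
apply/lee_addgt0Pr => e e0.
pose a := (Num.sqrt 2 * K1)%R; pose b := (2 * Num.sqrt 2 * K2)%R.
have a0 : (0 <= a)%R by rewrite mulr_ge0.
have b0 : (0 <= b)%R by rewrite mulr_ge0 // mulr_ge0.
have ab : (0 < a + b + 1)%R by rewrite ltr_wpDl // addr_ge0.
have e1 : (0 < e / (a + b + 1))%R by rewrite divr_gt0.
have [_ [A [A' [hA [hcA ->]]]] hlA] := lb_ereal_inf_adherent e1 fin1.
have [_ [B [B' [hB [hcB ->]]]] hlB] := lb_ereal_inf_adherent e1 fin2.
have [Rop [Rinv [h1 h2 h3]]] :=
  semigroup_similar _ _ _ _ _ _ _ _ _ _ hH hT lam0 tau0 hA hB hcA hcB.
apply: le_trans (_ : (opnorm ip Rop * opnorm ip Rinv)%:E <= _).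
  by apply: ereal_inf_lbound; exists Rop, Rinv.
move: hlA hlB; rewrite -/(sg_sim_const ip (rescale lam T)) -/(sim_const ip (T tau)).
rewrite -(fineK fin1) -(fineK fin2) -!EFinD !lte_fin lee_fin => hlA hlB.
apply: le_trans h3 _; rewrite -/K1 -/K2.
set x := (opnorm ip A * _)%R in hlA *; set y := (opnorm ip B * _)%R in hlB *.
set i1 := fine _ in hlA *; set i2 := fine _ in hlB *.
have h4 := ler_wpM2l a0 (ltW hlA); have h5 := ler_wpM2l b0 (ltW hlB).
have h6 : (a * (e / (a + b + 1)) + b * (e / (a + b + 1)) <= e)%R.
  rewrite -mulrDl mulrA ler_pdivrMr // mulrC ler_pM2l // lerDl //.
have -> : (Num.sqrt 2 * x * K1 + 2 * Num.sqrt 2 * y * K2 = a * x + b * y)%R.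
  by rewrite /a /b; ring.
have -> : (Num.sqrt 2 * i1 * K1 + 2 * Num.sqrt 2 * i2 * K2 = a * i1 + b * i2)%R.
  by rewrite /a /b; ring.
lra.
Qed.
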